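(* Let $G$ be a finitely presented group with a pseudocharacter $f\colon G\to\mathbb{R}$, and let $X$ be the graph constructed from $f$ as described in the context. Then $X$ is quasi-isometric to a simplicial tree $\Gamma$, and $G$ quasi-acts coboundedly on $\Gamma$.
   Context: **Pseudocharacters.** $f\colon G\to\mathbb{R}$ is a pseudocharacter if $f(\alpha^n)=nf(\alpha)$ for all $\alpha\in G$, $n\in\mathbb{Z}$, and $|f(\alpha)+f(\beta)-f(\alpha\beta)|$ is bounded over $\alpha,\beta\in G$; $\|\delta f\|$ denotes the least upper bound of this quantity. **The complex $\widetilde K$.** Choose a finite presentation $G=\langle S\mid R\rangle$ in which every word of $R$ has length three, with $S$ containing an element $s$ with $f(s)>\|\delta f\|$ (in particular $f\not\equiv0$). Let $\epsilon_{f,S}=\sup_{s\in S}|f(s)|+\|\delta f\|$. Scale $f$ by a positive real number so that $\epsilon_{f,S}<\frac14$ and $f(G)\cap(\mathbb{Z}+\frac12)=\emptyset$. Let $\widetilde K$ be the simply connected 2-complex obtained from the Cayley graph $\Gamma(G,S)$ by equivariantly adding triangles for the relators (the universal cover of the presentation complex), with its left $G$-action; extend $f$ from $G=\widetilde K^0$ affinely over all edges and triangles to $f\colon\widetilde K\to\mathbb{R}$. **The graph $X$.** Let $V$ be the set of connected components of $f^{-1}(\mathbb{Z}+\frac12)\subset\widetilde K$. $X$ is the simplicial graph with vertex set $G\times V$, where two distinct vertices $(g,\tau)$, $(g',\tau')$ are joined by an edge iff there are $h\in G$ and $n\in\mathbb{Z}$ such that $hg(\tau)$ and $hg'(\tau')$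 are contained in the same connected component of $f^{-1}[n-\frac32,n+\frac12]$. $X$ has the path metric with edges of length one, and $G$ acts on $X$ isometrically by extending $g(g_0,\tau_0)=(gg_0,\tau_0)$. **Quasi-actions.** A map $q\colon X\to Y$ of metric spaces is a $(K,C)$-quasi-isometry if $d(x_1,x_2)/K-C\le d(q(x_1),q(x_2))\le Kd(x_1,x_2)+C$ for all $x_1,x_2$ and every $y\in Y$ is within $C$ of $q(X)$. A $(K,C)$-quasi-action of $G$ on a metric space $Z$ is a map $A\colon G\times Z\to Z$ such that each $A(g,-)\colon Z\to Z$ is a $(K,C)$-quasi-isometry and $d(A(g,A(h,z)),A(gh,z))\le C$ for all $g,h\in G$, $z\in Z$. $G$ quasi-acts coboundedly on $Z$ if there is a $(K,C)$-quasi-action for some $K\ge1,C\ge0$ such that for every $z\in Z$ the map $g\mapsto A(g,z)$ is coarsely onto (every point of $Z$ is within some constant distance of its image). Trees carry the path metric with edges of length one. *)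

(* Defs.v *)
From HB Require Import structures.
From Stdlib Require Import Relations.
From mathcomp Require Import all_boot all_order all_algebra.
From mathcomp Require Import all_classical all_reals all_analysis.
Set Implicit Arguments.
Unset Strict Implicit.
Unset Printing Implicit Defensive.
Import Order.TTheory GRing.Theory Num.Theory.
Import numFieldNormedType.Exports.
Local Open Scope classical_set_scope.
Local Open Scope quotient_scope.
Local Open Scope ring_scope.

Section Pseudocharacter.
Context {R : realType} {G : groupType}.
Implicit Type f : G -> R.

Definition zexpg (a : G) (n : int) : G :=
  match n with Posz m => (a ^+ m)%g | Negz m => (a ^- m.+1)%g end.

Definition defects f : set R :=
  [set r | exists a b : G, r = `|f a + f b - f (a * b)%g|].

Definition is_pseudocharacter f : Prop :=
  (forall (a : G) (n : int), f (zexpg a n) = n%:~R * f a) /\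
  has_ubound (defects f).

Definition defect f : R := sup (defects f).

End Pseudocharacter.

(* Words over [S] and formal inverses; [(s, false)] stands for the inverse of
   [s]. *)
Definition letter (S : Type) : Type := (S * bool)%type.

Section Words.
Context {S : finType} {G : groupType} (ev : S -> G).

Definition letter_val (l : letter S) : G :=
  if l.2 then ev l.1 else ((ev l.1)^-1)%g.

Definition word_val (w : seq (letter S)) : G :=
  foldr (fun l g => (letter_val l * g)%g) 1%g w.

(* Elementary moves; the equivalence they generate is equality in the quotient
   of the free group on [S] by the normal closure of [rels]. *)
Inductive word_move (rels : {set 3.-tuple (S * bool)}) :
    seq (letter S) -> seq (letter S) -> Prop :=
| MoveCancel (u v : seq (letter S)) (s : S) (e : bool) :
    word_move rels (u ++ [:: (s, e); (s, ~~ e)] ++ v) (u ++ v)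
| MoveRelator (u v : seq (letter S)) (r : 3.-tuple (S * bool)) :
    r \in rels -> word_move rels (u ++ r ++ v) (u ++ v).

End Words.

(* [gen] need not be injective: the set of generators is an abstract finite
   set, as for any presentation. *)
Record tri_presentation (G : groupType) := TriPresentation {
  gens : finType;
  rels : {set 3.-tuple (gens * bool)};
  gen : gens -> G;
  gen_surj : forall g : G, exists w, word_val gen w = g;
  gen_rels : forall w1 w2, word_val gen w1 = word_val gen w2 <->
    clos_refl_sym_trans _ (word_move rels) w1 w2 }.

Definition epsilon (R : realType) (G : groupType) (P : tri_presentation G)
    (f : G -> R) : R :=
  sup [set `|f (gen s)| | s in [set: gens P]] + defect f.

Definition simplex (R : realType) (n : nat) : set 'rV[R]_n.+1 :=
  [set x | (forall j, 0 <= x ord0 j) /\ \sum_j x ord0 j = 1].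
Arguments simplex : clear implicits.

Section Complex.
Context (R : realType) {G : groupType} (P : tri_presentation G).

(* Orbits of cells under the free action of [G]; a cell is [(g, o)] where [g]
   is its base vertex. *)
Inductive cell_orbit : Type :=
| Vertex
| Edge of gens P
| Triangle of {r : 3.-tuple (gens P * bool) | r \in rels P}.

HB.instance Definition _ := gen_eqMixin cell_orbit.
HB.instance Definition _ := gen_choiceMixin cell_orbit.

Definition cell_dim (o : cell_orbit) : nat :=
  match o with Vertex => 0 | Edge _ => 1 | Triangle _ => 2 end.

Definition boundary_word (o : cell_orbit) : seq (letter (gens P)) :=
  match o with
  | Vertex => [::]
  | Edge s => [:: (s, true)]
  | Triangle r => tval (val r)
  end.

(* The [j]-th vertex of a cell: for the edge [s] at [g] these are [g] and
   [g s], for the triangle [abc] at [g] they are [g], [g a] and [g a b]. *)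
Definition corner (c : G * cell_orbit) (j : nat) : G :=
  (c.1 * word_val (@gen G P) (take j (boundary_word c.2)))%g.

(* Disjoint union of the closed cells, in barycentric coordinates. *)
Definition cells : Type :=
  {c : (G * cell_orbit)%type & set_type (simplex R (cell_dim c.2))}.
HB.instance Definition _ := Topological.on cells.

Definition pt (g : G) (o : cell_orbit) (x : set_type (simplex R (cell_dim o))) :
  cells := existT _ (g, o) x.

(* The side of a triangle from corner [i] to corner [i + 1 mod 3] is labelled
   by the [i]-th letter of the relator.  It is glued to the edge labelled by
   the generator of that letter, with the orientation reversed when the letter
   is an inverse. *)
Inductive glue : cells -> cells -> Prop :=
| GlueEnd (g : G) (s : gens P) (j : 'I_2) (x : set_type (simplex R 1))
    (y : set_type (simplex R 0)) :
    set_val x = delta_mx ord0 j ->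
    glue (pt g (o := Edge s) x) (pt (corner (g, Edge s) j) (o := Vertex) y)
| GlueSide (g : G) r (i : 'I_3) (t : R) (x : set_type (simplex R 2))
    (y : set_type (simplex R 1)) :
    let l := tnth (val r) i in
    let c := (g, Triangle r) in
    set_val x = (1 - t) *: delta_mx ord0 i + t *: delta_mx ord0 (ordS i) ->
    set_val y = (1 - t) *: delta_mx ord0 (if l.2 then ord0 else ord_max)
                + t *: delta_mx ord0 (if l.2 then ord_max else ord0) ->
    glue (pt g (o := Triangle r) x)
      (pt (if l.2 then corner c i else corner c (ordS i)) (o := Edge l.1) y).

Definition act_cells (h : G) (p : cells) : cells :=
  pt (h * (tag p).1)%g (o := (tag p).2) (tagged p).

Definition height_cells (f : G -> R) (p : cells) : R :=
  \sum_(j < (cell_dim (tag p).2).+1) set_val (tagged p) ord0 j * f (corner (tag p) j).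

Lemma word_val_rel r : r \in rels P -> word_val (@gen G P) r = 1%g.
Proof.
move=> rP; apply: (gen_rels r [::]).2; apply: rst_step.
by have := MoveRelator [::] [::] rP; rewrite /= cats0.
Qed.

Lemma cornerS (c : G * cell_orbit) (r : 3.-tuple (gens P * bool)) (i : 'I_3) :
  boundary_word c.2 = r -> r \in rels P ->
  corner c (ordS i) = (corner c i * letter_val (@gen G P) (tnth r i))%g.
Proof.
case: c => g o /= cr /word_val_rel r1.
have gr1 : (g * word_val (@gen G P) r)%g = g by rewrite r1 mulg1.
rewrite /corner /= cr; case: r r1 gr1 {cr} => -[|a [|b [|d [|? ?]]]] //= ? _ gr1.
case: i => -[|[|[|//]]] lt3; rewrite /tnth /= ?mulg1 // -?mulgA //.
by rewrite -{1}gr1 mulg1 !mulgA.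
Qed.

Lemma height_glue (f : G -> R) p q : glue p q -> height_cells f p = height_cells f q.
Proof.
case=> [g s j x y xE|g r i t x y l c xE yE]; rewrite /height_cells /=.
  have y1 : set_val y ord0 ord0 = 1.
    by have /set_mem[_] := valP y; rewrite big_ord1.
  rewrite big_ord1 y1 mul1r {2}/corner /= mulg1 (bigD1 j) //= big1 => [|k kj].
    by rewrite addr0 xE mxE !eqxx mul1r.
  by rewrite xE mxE (negPf kj) andbF mul0r.
have L : \sum_(k < 3) set_val x ord0 k * f (corner c k) =
    (1 - t) * f (corner c i) + t * f (corner c (ordS i)).
  rewrite xE; under eq_bigr do rewrite !mxE eqxx /= mulrDl.
  rewrite big_split (bigD1 i) //= [X in _ + X](bigD1 (ordS i)) //= !eqxx !mulr1.
  by rewrite !big1 ?addr0 // => k /negPf->; rewrite mulr0 mul0r.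
rewrite {}L big_ord_recl big_ord1 yE !mxE.
rewrite (cornerS i (erefl : boundary_word c.2 = val r) (valP r)) -/l.
case: l {yE} => s [] /=; rewrite /corner /letter_val /= !mulg1 ?mulgVK.
  by rewrite !mulr1 !mulr0 addr0 add0r.
by rewrite !mulr1 !mulr0 addr0 add0r addrC.
Qed.

Lemma act_glue (h : G) p q : glue p q -> glue (act_cells h p) (act_cells h q).
Proof.
case=> [g s j x y xE|g r i t x y l c xE yE]; rewrite /act_cells /=.
  by rewrite /corner mulgA; exact: GlueEnd.
have -> : (h * (if l.2 then corner c i else corner c (ordS i)))%g =
    if l.2 then corner ((h * g)%g, Triangle r) i
    else corner ((h * g)%g, Triangle r) (ordS i).
  by case: ifP => _; rewrite /corner /= mulgA.
exact: GlueSide xE yE.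
Qed.

Definition glued (p q : cells) : bool :=
  `[< clos_refl_sym_trans _ glue p q >].

Lemma glued_refl : reflexive glued.
Proof. by move=> p; apply/asboolP; exact: rst_refl. Qed.

Lemma glued_sym : symmetric glued.
Proof.
by move=> p q; apply/asboolP/asboolP => pq; exact: rst_sym.
Qed.

Lemma glued_trans : transitive glued.
Proof.
by move=> q p r /asboolP pq /asboolP qr; apply/asboolP; exact: rst_trans qr.
Qed.

Canonical glued_equiv := EquivRel glued glued_refl glued_sym glued_trans.

Definition complex : Type := quotient_topology {eq_quot glued_equiv}.
HB.instance Definition _ := Topological.on complex.
HB.instance Definition _ := Quotient.on complex.

Lemma repr_glued p : clos_refl_sym_trans _ glue (repr (\pi_complex p)) p.
Proof. by apply/asboolP; have /eqmodP := reprK (\pi_complex p). Qed.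

Definition complex_act (h : G) (z : complex) : complex :=
  \pi_complex (act_cells h (repr z)).

Lemma act_pi (h : G) (p : cells) :
  complex_act h (\pi_complex p) = \pi_complex (act_cells h p).
Proof.
suff : clos_refl_sym_trans _ glue (act_cells h (repr (\pi_complex p)))
    (act_cells h p) by move=> ?; apply/eqmodP/asboolP.
move: (repr _) (repr_glued p) => q; elim=> [x y xy|x|x y _ xy|x y z _ xy _ yz].
- exact/rst_step/act_glue.
- exact: rst_refl.
- exact: rst_sym.
- exact: rst_trans yz.
Qed.

(* The affine extension of [f], see [height_pi]. *)
Definition height (f : G -> R) (z : complex) : R := height_cells f (repr z).

Lemma height_pi (f : G -> R) (p : cells) :
  height f (\pi_complex p) = height_cells f p.
Proof.
rewrite /height; move: (repr _) (repr_glued p) => q.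
elim=> [x y|//|x y _ ->//|x y z _ -> _ ->//].
exact: height_glue.
Qed.

End Complex.

Definition components (T : topologicalType) (A : set T) : set (set T) :=
  [set C | exists2 x, A x & C = connected_component A x].

Record sgraph := SGraph {
  vertex :> eqType;
  adj : rel vertex;
  adj_sym : symmetric adj;
  adj_irr : irreflexive adj }.

Section GraphX.
Context {R : realType} {G : groupType} (P : tri_presentation G) (f : G -> R).

Definition half_level : set (complex R P) :=
  [set z | exists n : int, height f z = n%:~R + 2^-1].

Definition slab (n : int) : set (complex R P) :=
  [set z | n%:~R - 3 / 2 <= height f z <= n%:~R + 2^-1].

Definition X_vertex : eqType := (G * set_type (components half_level))%type.

(* For [u = (g, tau)] this is the subset [h g (tau)] of the complex. *)
Definition translate (h : G) (u : X_vertex) : set (complex R P) :=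
  complex_act (h * u.1)%g @` set_val u.2.

Definition X_adj (u v : X_vertex) : bool :=
  (u != v) && `[< exists (h : G) (n : int) (C : set (complex R P)),
    [/\ components (slab n) C, translate h u `<=` C & translate h v `<=` C] >].

Lemma X_adj_sym : symmetric X_adj.
Proof.
move=> u v; rewrite /X_adj eq_sym; congr (_ && _).
by apply/asboolP/asboolP => -[h [n [C [CC Cu Cv]]]]; exists h, n, C.
Qed.

Lemma X_adj_irr : irreflexive X_adj.
Proof. by move=> u; rewrite /X_adj eqxx. Qed.

Definition X_graph : sgraph := SGraph X_adj_sym X_adj_irr.

End GraphX.

Section MetricGraph.
Context (R : realType) (E : sgraph).

(* Barycentric coordinates of the point at parameter [t] on the edge from [u]
   to [v]. *)
Definition edge_pt (u v : E) (t : R) : E -> R :=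
  fun w => (1 - t) * (w == u)%:R + t * (w == v)%:R.

Definition realization : set (E -> R) :=
  [set x | exists (u v : E) (t : R),
     [/\ u = v \/ adj u v, 0 <= t <= 1 & x = edge_pt u v t]].

(* [chain x y l]: there is a piecewise linear path of length [l] from [x] to
   [y]. *)
Inductive chain : (E -> R) -> (E -> R) -> R -> Prop :=
| ChainNil (x : E -> R) : chain x x 0
| ChainStep (u v : E) (s t : R) (y : E -> R) (l : R) :
    adj u v -> 0 <= s <= 1 -> 0 <= t <= 1 ->
    chain (edge_pt u v t) y l -> chain (edge_pt u v s) y (`|s - t| + l).

(* The path metric with edges of length one; it is [+oo] between points in
   different components. *)
Definition graph_dist (x y : set_type realization) : \bar R :=
  ereal_inf [set l%:E | l in chain (set_val x) (set_val y)].

End MetricGraph.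

Definition is_tree (E : sgraph) : Prop :=
  [/\ exists x : E, True,
      forall x y : E, exists2 p, path (@adj E) x p & last x p = y &
      forall c : seq E, ucycle (@adj E) c -> (size c <= 2)%N].

Section Coarse.
Context {R : realType}.

Definition quasi_isometry (T U : Type) (dT : T -> T -> \bar R)
    (dU : U -> U -> \bar R) (K C : R) (q : T -> U) : Prop :=
  (forall x1 x2 : T,
     (K^-1%:E * dT x1 x2 - C%:E <= dU (q x1) (q x2))%E /\
     (dU (q x1) (q x2) <= K%:E * dT x1 x2 + C%:E)%E) /\
  (forall y : U, exists x : T, (dU y (q x) <= C%:E)%E).

Definition quasi_isometric (T U : Type) (dT : T -> T -> \bar R)
    (dU : U -> U -> \bar R) : Prop :=
  exists (K C : R) (q : T -> U),
    [/\ 1 <= K, 0 <= C & quasi_isometry dT dU K C q].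

Definition quasi_action (G : groupType) (Z : Type) (d : Z -> Z -> \bar R)
    (K C : R) (A : G -> Z -> Z) : Prop :=
  (forall g : G, quasi_isometry d d K C (A g)) /\
  (forall (g h : G) (z : Z), (d (A g (A h z)) (A (g * h)%g z) <= C%:E)%E).

Definition quasi_acts_coboundedly (G : groupType) (Z : Type)
    (d : Z -> Z -> \bar R) : Prop :=
  exists (K C : R) (A : G -> Z -> Z),
    [/\ 1 <= K, 0 <= C, quasi_action d K C A &
        forall z : Z, exists D : R, forall w : Z, exists g : G,
          (d w (A g z) <= D%:E)%E].

End Coarse.

(* Main.v *)
From HB Require Import structures.
From Stdlib Require Import Relations.
From mathcomp Require Import all_boot all_order all_algebra.
From mathcomp Require Import all_classical all_reals all_analysis.
From mathcomp Require Import lra ring zify.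
Require Import Defs.
Set Implicit Arguments.
Unset Strict Implicit.
Unset Printing Implicit Defensive.
Import Order.TTheory GRing.Theory Num.Theory.
Import numFieldNormedType.Exports.
Local Open Scope classical_set_scope.
Local Open Scope quotient_scope.
Local Open Scope ring_scope.

(** The graph X is a quasi-tree because of the tracks, that is, the components
    of [f] at half-integer heights.  The complex is simply connected, so every
    track cuts it into two pieces.

    Call two tracks linked if they lie in one component of a strip
    [n - 1/2 <= f <= n + 1/2].  A track [T] gives a vertex [(1, T)] of X, and
    linked tracks give equal or adjacent vertices.  In a shortest
    chain of linked tracks every inner track [T] separates the first track from
    the last one ([geodesic_separates]): its two neighbours lie in strips on
    opposite sides of [T], for otherwise they would be linked, and no other
    link of the chain touches [T], for otherwise the chain could be shortened.
    An edge of X joins two translated tracks that lie in one connected set, a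
    translated slab component [U].  Hence along a path of X between the ends
    of the chain some [U] meets [T].  Then both ends of that edge are within
    distance two of [T] ([meeting_component]): if [T] is not contained in [U],
    then from the common point one can climb along powers of a generator [s]
    with [f s] larger than the defect, and reach a track that lies in [U] and
    shares a slab with [T].  So every path of X from [x] to [y] passes close to
    all tracks of a coarse path from [x] to [y]: this is the bottleneck property
    ([X_bottleneck]).

    Any graph with the bottleneck property is quasi-isometric to a tree.  Fix
    a vertex [o].  The vertices of the tree are the components of the
    complements of the balls about [o], and inclusion of components of
    consecutive balls gives the edges.  Sending [x] to the component that has
    [x] on its boundary does not increase distances, and it decreases them by
    at most a constant since two points on the boundary of one component are
    close ([sphere_bound]): a path outside the ball, and the two geodesics to
    [o], all pass near every point of the coarse path, which forces its points
    to be near one of the two ends.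

    The group acts on X by automorphisms, and any two vertices become equal or
    adjacent after moving one of them ([X_cobounded]): the tracks can be moved
    close to the vertex [1].  Conjugating this action by the quasi-isometry gives
    the cobounded quasi-action on the tree ([bottleneck_quasi_tree]). *)

(** * Walks and distances in graphs *)

Section Walks.
Context {E : sgraph}.
Implicit Types (x y z : E) (Q : set E).
Local Open Scope nat_scope.

Definition step x y : Prop := x = y \/ adj x y.

Lemma step_refl x : step x x. Proof. by left. Qed.

Lemma stepC x y : step x y -> step y x.
Proof. by case=> [->|xy]; [left|right; rewrite adj_sym]. Qed.

Fixpoint within n x y : Prop :=
  if n is m.+1 then exists2 z, step x z & within m z y else x = y.

Lemma within_refl n x : within n x x.
Proof. by elim: n => //= n IH; exists x => //; exact: step_refl. Qed.

Lemma within_trans m n x y z : within m x y -> within n y z -> within (m + n) x z.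
Proof.
elim: m x => [|m IH] x /=; first by move->.
by move=> [w xw wy] yz; exists w => //; exact: IH.
Qed.

Lemma within1 x y : step x y -> within 1 x y.
Proof. by move=> xy; exists y. Qed.

Lemma withinC n x y : within n x y -> within n y x.
Proof.
elim: n x => [|n IH] x /=; first by move->.
by move=> [w xw /IH wy]; have := within_trans wy (within1 (stepC xw)); rewrite addn1.
Qed.

Lemma within_path n x y : within n x y -> exists2 p, path (@adj E) x p & last x p = y.
Proof.
elim: n x => [|n IH] x /=; first by move->; exists [::].
move=> [z [->|xz] /IH[p zp py]]; first by exists p.
by exists (z :: p); rewrite //= xz.
Qed.

Inductive joined_in Q : E -> E -> Prop :=
| JoinedRefl x : Q x -> joined_in Q x x
| JoinedStep x y z : Q x -> step x y -> joined_in Q y z -> joined_in Q x z.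

Lemma joined_left Q x y : joined_in Q x y -> Q x.
Proof. by case. Qed.

Lemma joined_right Q x y : joined_in Q x y -> Q y.
Proof. by elim. Qed.

Lemma joined_mono Q Q' x y : Q `<=` Q' -> joined_in Q x y -> joined_in Q' x y.
Proof.
move=> QQ'; elim=> [z /QQ'|a b c /QQ' Qa ab _ IH]; first exact: JoinedRefl.
exact: JoinedStep IH.
Qed.

Lemma joined_trans Q x y z : joined_in Q x y -> joined_in Q y z -> joined_in Q x z.
Proof. by elim=> // a b c Qa ab _ IH /IH; exact: JoinedStep. Qed.

Lemma joined1 Q x y : Q x -> Q y -> step x y -> joined_in Q x y.
Proof. by move=> Qx Qy xy; apply: JoinedStep xy _ => //; exact: JoinedRefl. Qed.

Lemma joinedC Q x y : joined_in Q x y -> joined_in Q y x.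
Proof.
elim=> [z|a b c Qa ab bc IH]; first exact: JoinedRefl.
by apply: (joined_trans IH); apply: joined1 (stepC ab) => //; exact: joined_left bc.
Qed.

End Walks.

Section Distance.
Context {E : sgraph} (conn : forall x y : E, exists n, within n x y).
Implicit Types (x y z : E).
Local Open Scope nat_scope.

Lemma exists_within x y : exists n, (fun n => `[< within n x y >]) n.
Proof. by have [n xy] := conn x y; exists n; apply/asboolP. Qed.

Definition dist x y : nat := ex_minn (exists_within x y).

Lemma distP x y : within (dist x y) x y.
Proof. by rewrite /dist; case: ex_minnP => n /asboolP. Qed.

Lemma dist_le n x y : within n x y -> dist x y <= n.
Proof. by rewrite /dist; case: ex_minnP => m _ min xy; apply/min/asboolP. Qed.

Lemma dist_triangle y x z : dist x z <= dist x y + dist y z.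
Proof. by apply/dist_le/within_trans; exact: distP. Qed.

Lemma distC x y : dist x y = dist y x.
Proof. by apply/eqP; rewrite eqn_leq !dist_le //; apply/withinC/distP. Qed.

Lemma distxx x : dist x x = 0.
Proof. by apply/eqP; rewrite -leqn0; exact: (@dist_le 0). Qed.

Lemma dist0 x y : dist x y = 0 -> x = y.
Proof. by move=> xy; have := distP x y; rewrite xy. Qed.

Lemma dist_step x y : step x y -> dist x y <= 1.
Proof. by move=> xy; exact/dist_le/within1. Qed.

Lemma dist_prev n x y : dist x y = n.+1 -> exists z, adj y z /\ dist x z = n.
Proof.
move=> xyn; have := distP y x; rewrite distC xyn /= => -[z yz zx].
exists z; have xz : dist x z <= n by rewrite distC; exact: dist_le.
case: yz => [yz|yz]; first by subst z; move: xyn xz; lia.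
split=> //; apply/eqP; rewrite eqn_leq xz /=.
have := dist_triangle z x y; have := dist_step (or_intror yz : step y z).
by rewrite (distC y); lia.
Qed.

Lemma dist_geodesic m x y : m <= dist x y ->
  exists2 z, dist x z = m & dist x z + dist z y = dist x y.
Proof.
have [n] := ubnP (dist x y); elim: n y => // n IH y xyn mxy.
have [->|ne] := eqVneq m (dist x y); first by exists y; rewrite // distxx addn0.
case d : (dist x y) mxy ne xyn => [|k] mk ne kn; first by lia.
have [w [yw xw]] := dist_prev d.
have [||z xz zw] := IH w; rewrite ?xw; try lia.
exists z => //; have := dist_triangle w z y; have := dist_triangle z x y.
by have := dist_step (or_intror yw : step y w); rewrite (distC y); lia.
Qed.

End Distance.

(** * The tree of components outside balls *)

(** Every path from [x] to [y] passes close to each point of some coarse path.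
    Paths are only recorded through a set [Q] that contains them, so that the
    property applies at once to geodesics and to paths far from a base point. *)
Definition bottleneck (E : sgraph) : Prop := forall x y : E,
  exists (N : nat) (z : nat -> E),
    [/\ step x (z 0%N), step (z N) y, forall i, (i < N)%N -> step (z i) (z i.+1) &
        forall (Q : set E) i, (i <= N)%N -> joined_in Q x y -> exists2 w, Q w & within 2 w (z i)].

Section TreeOfComponents.
Context {E : sgraph} (conn : forall x y : E, exists n, within n x y)
  (o : E) (bottle : bottleneck E).
Implicit Types (x y z : E).
Local Open Scope nat_scope.
Notation dist := (dist conn).
Notation depth x := (dist o x).
Definition outside (n : nat) : set E := [set w | n <= depth w].

(** On a geodesic that leaves [w] straight away from [o], the depth only increases. *)
Lemma joined_geodesic m w x : m <= depth w -> depth w + dist w x = depth x ->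
  joined_in [set v | m <= depth v /\ depth v + dist v x = depth x] w x.
Proof.
have [n] := ubnP (dist w x); elim: n w => // n IH w wn mw wx.
case d : (dist w x) => [|k].
  by rewrite -(dist0 d); apply: JoinedRefl; rewrite /= distxx addn0.
have [v [wv xv]] : exists v, adj w v /\ dist x v = k by apply: dist_prev; rewrite distC.
have s : step w v by right.
have := dist_step conn s; have := dist_triangle conn v o x; have := dist_triangle conn w o v.
have vx : dist v x = k by rewrite distC.
rewrite vx => ? ? ?.
apply: JoinedStep s _; first by [].
by apply: IH; lia.
Qed.

(** The coarse path of the bottleneck property has depth at least [n - 2], by
    the path outside the ball, and it passes within [2] of geodesics from [x]
    and from [y] to [o].  Such a geodesic has depth at least [n - 4] only within
    [4] of its end, so each point of the coarse path is within [6] of [x] or [y].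
    Two consecutive points near different ends give [13 = 6 + 1 + 6]. *)
Lemma sphere_bound n x y : depth x = n -> depth y = n ->
  joined_in (outside n) x y -> dist x y <= 13.
Proof.
move=> xn yn xy; have [N [z [xz zy zz bot]]] := bottle x y.
pose Q : set E := [set w | depth w + dist w x = n \/ depth w + dist w y = n].
have Qxy : joined_in Q x y.
  apply: (@joined_trans _ _ _ o).
    apply/joinedC; have := @joined_geodesic 0 o x (leq0n _); rewrite distxx => /(_ erefl).
    by apply: joined_mono => w [_]; rewrite xn; left.
  have := @joined_geodesic 0 o y (leq0n _); rewrite distxx => /(_ erefl).
  by apply: joined_mono => w [_]; rewrite yn; right.
have close i : i <= N -> dist (z i) x <= 6 \/ dist (z i) y <= 6.
  move=> iN; have [v nv /dist_le-/(_ conn) vz] := bot _ i iN xy.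
  have [w Qw /dist_le-/(_ conn) wz] := bot _ i iN Qxy.
  have := dist_triangle conn (z i) o v; have := dist_triangle conn w o (z i).
  have := dist_triangle conn w (z i) x; have := dist_triangle conn w (z i) y.
  rewrite /outside /= in nv; rewrite (distC conn (z i) w) (distC conn (z i) v) => ? ? ? ?.
  by case: Qw => ?; [left|right]; lia.
have xz0 := dist_step conn xz; have zNy := dist_step conn zy.
have [far|near] := leqP (dist (z N) x) 6.
  by have := dist_triangle conn (z N) x y; rewrite (distC conn x (z N)); lia.
have exi : exists i, (i <= N) && (6 < dist (z i) x) by exists N; rewrite leqnn.
(* the first point of the coarse path that is far from [x] *)
case: (ex_minnP exi) => -[|i] /andP[iN far] min.
  by move: far; rewrite distC; lia.
have [|zy6] := close _ iN; first by lia.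
have zx6 : dist (z i) x <= 6.
  rewrite leqNgt; apply/negP => h; have := min i; rewrite h ltnn andbT => /(_ (ltnW iN)).
  by [].
have zz1 := dist_step conn (zz i iN).
have := dist_triangle conn (z i) x y; have := dist_triangle conn (z i.+1) (z i) y.
by rewrite (distC conn x (z i)); lia.
Qed.

(** The component of [x] outside the ball whose sphere contains [x].  As a set it
    determines the depth of [x], the least depth of its elements; hence the
    level need not be recorded in the vertices of the tree. *)
Definition branch x : set E := [set y | joined_in (outside (depth x)) x y].

Lemma branch_id x : branch x x.
Proof. by apply: JoinedRefl; rewrite /outside /=. Qed.

Lemma branch_depth x y : branch x y -> depth x <= depth y.
Proof. exact: joined_right. Qed.

Lemma branch_eq x y : depth x = depth y -> branch x y -> branch x = branch y.
Proof.
rewrite /branch /= => xy jxy; apply/seteqP; split => z /= jz.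
  by rewrite -xy; exact: joined_trans (joinedC jxy) jz.
by rewrite -xy in jz; exact: joined_trans jxy jz.
Qed.

Lemma branch_eqP x y : branch x = branch y -> depth x = depth y /\ branch x y.
Proof.
move=> xy; have xb : branch x y by rewrite xy; exact: branch_id.
split => //; apply/eqP; rewrite eqn_leq branch_depth // branch_depth // -xy.
exact: branch_id.
Qed.

Definition tree_vertex : eqType := set_type (range branch).

Definition to_tree x : tree_vertex := SigSub (mem_set (imageT branch x)).

Lemma to_treeP x y : to_tree x = to_tree y <-> branch x = branch y.
Proof. by split => [/(congr1 val)|xy]; last exact: val_inj. Qed.

Lemma to_tree_surj (A : tree_vertex) : exists x, to_tree x = A.
Proof. by case/set_mem: (valP A) => x _ xA; exists x; exact: val_inj. Qed.

Definition tree_child (A B : tree_vertex) : Prop := exists x y,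
  [/\ adj x y, depth y = (depth x).+1, to_tree x = A & to_tree y = B].

Definition tree_adj (A B : tree_vertex) : bool := `[< tree_child A B \/ tree_child B A >].

Lemma tree_depth A B : tree_child A B -> forall x y, to_tree x = A -> to_tree y = B ->
  depth y = (depth x).+1.
Proof.
move=> [x [y [_ xy <- <-]]] x' y' /to_treeP/branch_eqP[xx' _] /to_treeP/branch_eqP[yy' _].
by rewrite xx' yy'.
Qed.

Lemma tree_adj_sym : symmetric tree_adj.
Proof. by move=> A B; apply/asboolP/asboolP => -[]; [right|left|right|left]. Qed.

Lemma tree_adj_irr : irreflexive tree_adj.
Proof.
move=> A; apply/asboolP; have [x xA] := to_tree_surj A.
by case=> /tree_depth/(_ x x xA xA); lia.
Qed.

Definition component_tree : sgraph := SGraph tree_adj_sym tree_adj_irr.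
Notation to_tree' := (to_tree : E -> component_tree).

(** Below a common child, the two parents are joined through that child. *)
Lemma parent_unique A B C : tree_child A C -> tree_child B C -> A = B.
Proof.
move=> [a [c [ac ca <- cC]]] [b [c' [bc' c'b <- c'C]]].
have /to_treeP/branch_eqP[cc' jc] : to_tree c = to_tree c' by rewrite cC c'C.
apply/to_treeP/branch_eq; first lia.
have out n v : n <= depth v -> outside n v by [].
apply: (@joined_trans _ _ _ c).
  by apply: joined1; [apply: out|apply: out; lia|right].
apply: (@joined_trans _ _ _ c').
  by apply: joined_mono jc => v; rewrite /outside /=; lia.
by apply: joined1; [apply: out; lia|apply: out; lia|right; rewrite adj_sym].
Qed.

Lemma to_tree_step x y : step x y -> step (to_tree' x) (to_tree' y).
Proof.
case=> [->|xy]; first by left.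
have s : step x y by right.
have := dist_step conn s; have := dist_triangle conn x o y; have := dist_triangle conn y o x.
rewrite (distC conn y x) => h1 h2 h3.
have [e|ne] := eqVneq (depth x) (depth y).
  left; apply/to_treeP/branch_eq => //; apply: joined1 => //; rewrite /outside /=; lia.
right; apply/asboolP; case: (ltnP (depth x) (depth y)) => lt;
  [left; exists x, y|right; exists y, x].
  by split => //; lia.
by split => //; [rewrite adj_sym|lia].
Qed.

Lemma to_tree_within n x y : within n x y -> within n (to_tree' x) (to_tree' y).
Proof.
elim: n x => [|n IH] x /=; first by move->.
by move=> [z xz /IH zy]; exists (to_tree' z) => //; exact: to_tree_step.
Qed.

Lemma tree_connected (A B : component_tree) : exists n, within n A B.
Proof.
have [x <-] := to_tree_surj A; have [y <-] := to_tree_surj B.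
by have [n xy] := conn x y; exists n; exact: to_tree_within.
Qed.

(** On a cycle, both neighbours of a vertex of maximal depth are its parent. *)
Lemma component_tree_is_tree : is_tree component_tree.
Proof.
split; first by exists (to_tree o).
  by move=> A B; have [n /within_path] := tree_connected A B.
move=> c cyc; rewrite leqNgt; apply/negP => c3.
pose lvl (A : component_tree) := depth (projT1 (cid (to_tree_surj A))).
have lvlP A B : tree_child A B -> lvl B = (lvl A).+1.
  by move=> AB; apply: (tree_depth AB); rewrite /lvl; case: cid.
have [A Ac Amax] : exists2 A, A \in c & forall B, B \in c -> lvl B <= lvl A.
  have c0 : exists A, A \in c by case: (c) c3 => // A ? _; exists A; rewrite mem_head.
  have [A0 A0c] := c0.
  have [i _ imax] := @arg_maxnP _ (Ordinal (ltn_trans (isT : 0 < 2) c3)) predT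
    (fun i : 'I_(size c) => lvl (nth A0 c i)) isT.
  exists (nth A0 c i); first exact: mem_nth.
  move=> B Bc; have ic : index B c < size c by rewrite index_mem.
  by have := imax (Ordinal ic) isT; rewrite /= nth_index.
have [k p cE] := rot_to Ac.
have : ucycle (@adj component_tree) (A :: p) by rewrite -cE rot_ucycle.
have p2 : 2 <= size p by rewrite -ltnS -[(size p).+1]/(size (A :: p)) -cE size_rot.
have pc B : B \in p -> B \in c by move=> Bp; rewrite -(mem_rot k) cE inE Bp orbT.
have below B : B \in p -> tree_adj A B -> tree_child B A.
  by move=> /pc/Amax BA /asboolP[] // /lvlP; lia.
case: p p2 pc below {cE} => [//|B [//|B' p]] _ pc below /andP[] /andP[AB /andP[_ walk]] uq.
have LA : tree_adj (last B' p) A.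
  have : path (@adj component_tree) B' (rcons p A) by [].
  by rewrite rcons_path => /andP[].
have BA : tree_child B A by apply: below; rewrite ?mem_head.
have LA' : tree_child (last B' p) A.
  by apply: below; [rewrite inE mem_last orbT|rewrite tree_adj_sym].
move: uq; rewrite (parent_unique BA LA') => /andP[_ /andP[]].
by rewrite mem_last.
Qed.

(** The number [m] is the least depth reached by the walk in the tree: the walk
    has to descend from [x] to depth [m] and to climb again to [y], and it does
    not leave the component at depth [m]. *)
Lemma tree_walk n x y : within n (to_tree' x) (to_tree' y) -> exists m,
  [/\ m <= depth x, m <= depth y, joined_in (outside m) x y & depth x + depth y <= n + m.*2].
Proof.
elim: n y => [|n IH] y.
  move=> /to_treeP/branch_eqP[xy bxy]; exists (depth x).
  by split => //; lia.
move=> /withinC[A yA /withinC xA].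
have [y' y'A] := to_tree_surj A; rewrite -y'A in yA xA.
have [m [mx my' jxy' len]] := IH y' xA.
have join_y z w : m <= depth w -> to_tree z = to_tree w -> joined_in (outside m) z w.
  move=> mz /to_treeP/branch_eqP[zw bzw]; apply: joined_mono bzw => v.
  by rewrite /outside /= zw; exact: leq_trans.
case: yA => [e|/asboolP[] [a [b [ab ba aE bE]]]].
- have /to_treeP/branch_eqP[yy' _] : to_tree y = to_tree y' by [].
  exists m; split=> //; [lia| |lia].
  by apply: joined_trans jxy' _; apply: join_y => //; lia.
- (* [y] is the parent of [y'] *)
  have /to_treeP/branch_eqP[ya _] : to_tree y = to_tree a by [].
  have /to_treeP/branch_eqP[y'b jy'b] : to_tree y' = to_tree b by [].
  have /to_treeP/branch_eqP[_ jay] : to_tree a = to_tree y by [].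
  exists (minn m (depth y)).
  have le v : minn m (depth y) <= depth v -> outside (minn m (depth y)) v by [].
  split; [lia|lia| |lia].
  apply: (@joined_trans _ _ _ y').
    by apply: joined_mono jxy' => v; rewrite /outside /=; lia.
  apply: (@joined_trans _ _ _ b).
    by apply: joined_mono jy'b => v; rewrite /outside /=; lia.
  apply: (@joined_trans _ _ _ a).
    by apply: joined1; [apply: le; lia|apply: le; lia|right; rewrite adj_sym].
  by apply: joined_mono jay => v; rewrite /outside /=; lia.
- (* [y] is a child of [y'] *)
  have /to_treeP/branch_eqP[y'a jy'a] : to_tree y' = to_tree a by [].
  have /to_treeP/branch_eqP[by_ jby] : to_tree b = to_tree y by [].
  exists m; split; [lia|lia| |lia].
  apply: (joined_trans jxy'); apply: (@joined_trans _ _ _ a).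
    by apply: joined_mono jy'a => v; rewrite /outside /=; lia.
  apply: (@joined_trans _ _ _ b).
    by apply: joined1; [rewrite /outside /=; lia|rewrite /outside /=; lia|right].
  by apply: joined_mono jby => v; rewrite /outside /=; lia.
Qed.

(** The geodesics from [x] and [y] towards [o] meet the sphere of radius [m] in
    points of the same component outside the ball, to which [sphere_bound] applies. *)
Lemma within_of_tree n x y : within n (to_tree' x) (to_tree' y) -> within (n + 13) x y.
Proof.
move=> /tree_walk[m [mx my jxy len]].
have [x' ox' xx'] := dist_geodesic mx; have [y' oy' yy'] := dist_geodesic my.
have out w w' : depth w = m -> depth w + dist w w' = depth w' -> joined_in (outside m) w w'.
  move=> wm /(joined_geodesic (m := m)); rewrite wm leqnn => /(_ isT).
  by apply: joined_mono => v [].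
have b : dist x' y' <= 13.
  apply: (sphere_bound ox' oy').
  apply: (joined_trans (out x' x ox' xx')); apply: (joined_trans jxy).
  exact/joinedC/(out y' y).
have := distP conn x y; have : dist x y <= n + 13.
  have := dist_triangle conn x' x y; have := dist_triangle conn y' x' y.
  by rewrite (distC conn x x'); lia.
by move=> /subnK <-; rewrite addnC => xy; exact: within_trans xy (within_refl _ _).
Qed.

End TreeOfComponents.

(** * The path metric of the realization of a graph *)

Section Realization.
Context {R : realType} {E : sgraph} (conn : forall x y : E, exists n, within n x y).
Implicit Types (u v w : E) (s t l : R).
Notation dist := (dist conn).
Notation points := (set_type (@realization R E)).

Lemma big_pred1_seq (r : seq E) (a : E -> R) u : uniq r -> u \in r ->
  \sum_(w <- r) (w == u)%:R * a w = a u.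
Proof.
move=> ur ru; rewrite (bigD1_seq u) //= eqxx mul1r big1 ?addr0 // => w /negPf->.
by rewrite mul0r.
Qed.

(** The affine extension to the realization of a function on vertices is well
    defined: it is a finite sum weighted by barycentric coordinates. *)
Lemma edge_pt_affine (a : E -> R) u v s u' v' s' : edge_pt u v s = edge_pt u' v' s' ->
  (1 - s) * a u + s * a v = (1 - s') * a u' + s' * a v'.
Proof.
move=> e; pose r := undup [:: u; v; u'; v'].
have sumE u0 v0 s0 : u0 \in r -> v0 \in r ->
    \sum_(w <- r) edge_pt u0 v0 s0 w * a w = (1 - s0) * a u0 + s0 * a v0.
  move=> ur vr; rewrite /edge_pt; under eq_bigr do rewrite mulrDl -!mulrA.
  by rewrite big_split /= -!mulr_sumr !big_pred1_seq // undup_uniq.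
by rewrite -!sumE ?e // mem_undup !inE eqxx ?orbT.
Qed.

(** A function that changes by at most one along edges has a 1-Lipschitz affine
    extension.  For the distance from a vertex, this bounds lengths from below. *)
Lemma chain_affine (a : E -> R) (lip : forall u v, adj u v -> `|a u - a v| <= 1) x y l :
  chain x y l -> forall u v s u' v' s', x = edge_pt u v s -> y = edge_pt u' v' s' ->
  `|((1 - s) * a u + s * a v) - ((1 - s') * a u' + s' * a v')| <= l.
Proof.
elim=> [{}x u v s u' v' s' -> /edge_pt_affine->|]; first by rewrite subrr normr0.
move=> u0 v0 s0 t0 z m uv _ _ _ IH u v s u' v' s' /edge_pt_affine<- zE.
have := IH u0 v0 t0 _ _ _ erefl zE; set b := _ + _ => h.
rewrite -(subrKA ((1 - t0) * a u0 + t0 * a v0)).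
apply: (le_trans (ler_normD _ _)); apply: lerD => //.
rewrite (_ : _ - _ = (s0 - t0) * (a v0 - a u0)); last by ring.
by rewrite normrM ler_piMr // distrC lip.
Qed.

Lemma vertex_realization u : @realization R E (edge_pt u u 0).
Proof. by exists u, u, 0; split; [left|rewrite lexx ler01|]. Qed.

Definition vertex_of u : points := SigSub (mem_set (vertex_realization u)).

Lemma realization_node (p : points) : exists u v s,
  [/\ step u v, 0 <= s <= 1 & set_val p = edge_pt u v s].
Proof. by have /set_mem[u [v [s [uv s01 pE]]]] := valP p; exists u, v, s. Qed.

Definition node (p : points) : E := projT1 (cid (realization_node p)).

Lemma nodeP (p : points) : exists v s,
  [/\ step (node p) v, 0 <= s <= 1 & set_val p = edge_pt (node p) v s].
Proof. by rewrite /node; case: cid. Qed.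

Lemma chain_cat (x y z : E -> R) l m : chain x y l -> chain y z m -> chain x z (l + m).
Proof.
elim=> [w|u v s t w k uv s01 t01 _ IH] ch; first by rewrite add0r.
by rewrite -addrA; apply: ChainStep => //; exact: IH.
Qed.

Lemma edge_pt_swap u v s : edge_pt u v s = edge_pt v u (1 - s) :> (E -> R).
Proof. by apply/funext => w; rewrite /edge_pt subKr addrC. Qed.

Lemma edge_pt0 u v : edge_pt u v 0 = edge_pt u u 0 :> (E -> R).
Proof. by apply/funext => w; rewrite /edge_pt !mul0r. Qed.

Lemma edge_pt_const u s : edge_pt u u s = edge_pt u u 0 :> (E -> R).
Proof. by apply/funext => w; rewrite /edge_pt -mulrDl subrK mul0r addr0 subr0. Qed.

Lemma chain_to_vertex u v s : step u v -> 0 <= s <= 1 ->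
  exists2 l, chain (edge_pt u v s) (edge_pt u u 0) l & l <= 1.
Proof.
move=> [->|uv] s01; first by rewrite edge_pt_const; exists 0 => //; exact: ChainNil.
have := ChainStep uv s01 (t := 0) _ (ChainNil _); rewrite lexx ler01 => /(_ isT).
rewrite edge_pt0 => ch; exists (`|s - 0| + 0) => //.
by case/andP: s01 => ? ?; rewrite subr0 addr0 ger0_norm.
Qed.

Lemma chain_from_vertex u v s : step u v -> 0 <= s <= 1 ->
  exists2 l, chain (edge_pt u u 0) (edge_pt u v s) l & l <= 1.
Proof.
move=> [->|uv] s01; first by rewrite edge_pt_const; exists 0 => //; exact: ChainNil.
have := ChainStep uv (s := 0) _ s01 (ChainNil _); rewrite lexx ler01 => /(_ isT).
rewrite edge_pt0 => ch; exists (`|0 - s| + 0) => //.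
by case/andP: s01 => ? ?; rewrite sub0r normrN addr0 ger0_norm.
Qed.

Lemma chain_within n u v : within n u v ->
  exists2 l, chain (edge_pt u u 0 : E -> R) (edge_pt v v 0) l & l <= n%:R.
Proof.
elim: n u => [|n IH] u; first by move=> ->; exists 0 => //; exact: ChainNil.
case=> w uw /IH[l ch ln].
have [m ch1 m1] := @chain_from_vertex u w 1 uw ltac:(by rewrite lexx ler01).
rewrite (edge_pt_swap u w) subrr (edge_pt0 w) in ch1.
by exists (m + l); [exact: chain_cat ch|rewrite -natr1; lra].
Qed.

Lemma graph_dist_le (p q : points) n : within n (node p) (node q) ->
  (graph_dist p q <= (n%:R + 2)%:E)%E.
Proof.
move=> pq; have [v [s [pv s01 pE]]] := nodeP p; have [w [t [qw t01 qE]]] := nodeP q.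
have [l1 ch1 l11] := chain_to_vertex pv s01; have [l2 ch2 l2n] := chain_within pq.
have [l3 ch3 l31] := chain_from_vertex qw t01.
apply: (@le_trans _ _ ((l1 + l2) + l3)%:E).
  apply: ereal_inf_lbound; exists ((l1 + l2) + l3) => //=; rewrite pE qE.
  by apply: chain_cat ch3; exact: chain_cat ch2.
by rewrite lee_fin; lra.
Qed.

Lemma graph_dist_ge (p q : points) :
  (((dist (node p) (node q))%:R - 2)%:E <= graph_dist p q)%E.
Proof.
have [v [s [pv s01 pE]]] := nodeP p; have [w [t [qw t01 qE]]] := nodeP q.
apply: le_ereal_inf_tmp => _ /= [l ch <-]; rewrite lee_fin.
pose a x : R := (dist (node p) x)%:R.
have close (x y : E) : step x y -> `|a x - a y| <= 1.
  move=> xy; have yx := stepC xy.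
  have := dist_triangle conn x (node p) y; have := dist_triangle conn y (node p) x.
  have := dist_step conn xy; have := dist_step conn yx.
  rewrite /a -!(ler_nat R) !natrD => ? ? ? ?.
  by rewrite ler_norml; apply/andP; split; lra.
have := @chain_affine a (fun x y xy => close x y (or_intror xy)) _ _ _ ch _ _ _ _ _ _ pE qE.
have := close _ _ pv; have := close _ _ qw.
have -> : a (node p) = 0 by rewrite /a distxx.
rewrite -/(a (node q)) !ler_norml => /andP[? ?] /andP[? ?] /andP[? ?].
case/andP: s01 => ? ?; case/andP: t01 => ? ?.
nra.
Qed.

(** A vertex also is an end point of its edges, so [node] may return a neighbour. *)
Lemma node_vertex u : (dist (node (vertex_of u)) u <= 1)%N.
Proof.
have [v [s [pv s01 pE]]] := nodeP (vertex_of u).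
pose a x : R := (x == u)%:R.
have := edge_pt_affine a pE; rewrite /a eqxx subr0 mul0r addr0 mulr1.
have [->|_] := eqVneq (node (vertex_of u)) u; first by rewrite distxx.
have [vu _|_] := eqVneq v u; first by apply: dist_step; rewrite vu in pv.
by rewrite !mulr0 addr0 => /eqP; rewrite oner_eq0.
Qed.

End Realization.

(** * Quasi-actions on the tree of a bottleneck graph *)

Section CoarseIsometry.
Context {R : realType} {E E' : sgraph} (conn : forall x y : E, exists n, within n x y)
  (conn' : forall x y : E', exists n, within n x y) (phi : E -> E') (k : nat).

Definition coarse_isometry : Prop :=
  (forall u v, dist conn' (phi u) (phi v) <= dist conn u v + k /\
     dist conn u v <= dist conn' (phi u) (phi v) + k)%N /\
  (forall w, exists u, dist conn' w (phi u) <= k)%N.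

(** Points of edges are first moved to vertices: this changes distances by a
    bounded amount only. *)
Definition extend (p : set_type (@realization R E)) : set_type (@realization R E') :=
  vertex_of (phi (node p)).

Lemma dist_nodes u v : (dist conn' (node (@vertex_of R _ u)) (node (@vertex_of R _ v)) <=
  dist conn' u v + 2 /\ dist conn' u v <=
  dist conn' (node (@vertex_of R _ u)) (node (@vertex_of R _ v)) + 2)%N.
Proof.
have := @node_vertex R _ conn' u; have := @node_vertex R _ conn' v.
set u' := node (vertex_of u); set v' := node (vertex_of v) => vv' uu'.
have := dist_triangle conn' u u' v'; have := dist_triangle conn' v u v'.
have := dist_triangle conn' u' u v; have := dist_triangle conn' v' u' v.
by rewrite (distC conn' v v') (distC conn' u u'); lia.
Qed.

Lemma coarse_isometry_quasi_isometry : coarse_isometry ->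
  quasi_isometry (@graph_dist R E) (@graph_dist R E') 1 (2 * k%:R + 6) extend.
Proof.
move=> [iso onto]; split=> [p q|p].
  have [le_phi ge_phi] := iso (node p) (node q).
  have [n1 n2] := dist_nodes (phi (node p)) (phi (node q)).
  have lo := graph_dist_ge conn p q; have hi := graph_dist_le (distP conn (node p) (node q)).
  have lo' := graph_dist_ge conn' (extend p) (extend q).
  have hi' := graph_dist_le (distP conn' (node (extend p)) (node (extend q))).
  rewrite invr1 !mul1e; split.
    rewrite leeBlDr //; apply: (le_trans hi); apply: le_trans (leeD2r _ lo').
    rewrite -EFinD lee_fin /extend.
    by move: n1 n2 le_phi ge_phi; rewrite -!(ler_nat R) !natrD => *; lra.
  apply: (le_trans hi'); apply: le_trans (leeD2r _ lo).
  rewrite -EFinD lee_fin /extend.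
  by move: n1 n2 le_phi ge_phi; rewrite -!(ler_nat R) !natrD => *; lra.
have [u pu] := onto (node p); exists (vertex_of u).
apply: (le_trans (graph_dist_le (distP conn' _ _))); rewrite lee_fin.
have h1 := @node_vertex R _ conn' (phi (node (@vertex_of R _ u))).
have h2 := @node_vertex R _ conn u.
have [h3 _] := iso (node (@vertex_of R _ u)) u.
rewrite -/(extend (vertex_of u)) in h1 *; set v := phi (node (vertex_of u)) in h1 h3.
set w := node (extend _) in h1 *.
have := dist_triangle conn' (phi u) (node p) w; have := dist_triangle conn' v (phi u) w.
rewrite (distC conn' v w) (distC conn' (phi u) v) => h4 h5.
have : (dist conn' (node p) w <= 2 * k + 2)%N by lia.
by rewrite -(ler_nat R) natrD natrM; lra.
Qed.

End CoarseIsometry.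

(** The map to the tree of components is a coarse isometry and has a section
    [r].  Conjugating automorphisms of [E] by it gives coarse isometries of the
    tree that compose up to a bounded error. *)
Theorem bottleneck_quasi_tree (R : realType) (E : sgraph) (G : groupType)
    (act : G -> E -> E) (o : E) :
  (forall u, act 1%g u = u) -> (forall g h u, act g (act h u) = act (g * h)%g u) ->
  (forall g u v, step u v -> step (act g u) (act g v)) ->
  (forall u v, exists g, step (act g u) v) ->
  bottleneck E ->
  exists Gamma : sgraph,
    [/\ is_tree Gamma, quasi_isometric (@graph_dist R E) (@graph_dist R Gamma) &
        quasi_acts_coboundedly G (@graph_dist R Gamma)].
Proof.
move=> act1 actM act_step cobounded bottle.
have conn (x y : E) : exists n, within n x y.
  have [N [z [xz zy zz _]]] := bottle x y.
  have zN n : (n <= N)%N -> within n (z 0%N) (z n).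
    elim: n => [//|n IH] nN; have nN' := ltnW nN.
    by have := within_trans (IH nN') (within1 (zz n nN)); rewrite addn1.
  exists (1 + (N + 1))%N; apply: within_trans (within1 xz) _.
  exact: within_trans (zN N (leqnn N)) (within1 zy).
pose T := component_tree conn o; pose connT := @tree_connected E conn o.
pose q : E -> T := to_tree conn o.
have q_le x y : (dist connT (q x) (q y) <= dist conn x y)%N.
  by apply/dist_le/to_tree_within; exact: distP.
have q_ge x y : (dist conn x y <= dist connT (q x) (q y) + 13)%N.
  by apply/dist_le/(within_of_tree bottle); exact: distP.
pose r (v : T) : E := projT1 (cid (to_tree_surj v)).
have rK v : q (r v) = v by rewrite /r; case: cid.
have act_dist g x y : dist conn (act g x) (act g y) = dist conn x y.
  have le h u v : (dist conn (act h u) (act h v) <= dist conn u v)%N.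
    apply: dist_le; have := distP conn u v; move: (dist _ u v) => n.
    elim: n u => [|n IH] u /=; first by move->.
    by case=> w /(act_step h) uw /IH; exists (act h w).
  apply/eqP; rewrite eqn_leq le /=.
  by have := le (g^-1)%g (act g x) (act g y); rewrite !actM !mulVg !act1.
pose phi g (v : T) : T := q (act g (r v)).
have phi_iso g : coarse_isometry connT connT (phi g) 13.
  split=> [u v|w]; last first.
    exists (q (act (g^-1)%g (r w))); rewrite -{1}(rK w) distC /phi.
    apply: leq_trans (q_le _ _) _; rewrite -(act_dist (g^-1)%g) !actM mulVg act1.
    by apply: leq_trans (q_ge _ _) _; rewrite rK distxx.
  split.
    apply: leq_trans (q_le _ _) _; rewrite act_dist; apply: leq_trans (q_ge _ _) _.
    by rewrite !rK.
  rewrite -{1}(rK u) -{1}(rK v); apply: leq_trans (q_le _ _) _.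
  by rewrite -(act_dist g).
exists T; split; first exact: component_tree_is_tree.
  exists 1, (2 * 13%:R + 6), (extend q); split; [by []|lra|].
  apply: (coarse_isometry_quasi_isometry (conn := conn) (conn' := connT)).
  split=> [u v|w]; first by split; [apply: leq_trans (q_le _ _) (leq_addr _ _)|].
  by have [u <-] := to_tree_surj w; exists u; rewrite distxx.
have near (p p' : set_type (@realization R T)) (n : nat) : (n <= 30)%N ->
    (dist connT (node p) (node p') <= n)%N -> (graph_dist p p' <= (2 * 13%:R + 6)%:E)%E.
  move=> n30 ppn; apply: le_trans (graph_dist_le (distP connT _ _)) _.
  rewrite lee_fin.
  have : (dist connT (node p) (node p') <= 30)%N by exact: leq_trans n30.
  by rewrite -(ler_nat R); lra.
exists 1, (2 * 13%:R + 6), (fun g => extend (phi g)); split; [by []|lra| |].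
  split=> [g|g h z]; first exact: coarse_isometry_quasi_isometry.
  apply: (near _ _ 16%N) => //; rewrite /extend.
  set w := node (vertex_of (phi h (node z))).
  have [nodes _] := dist_nodes (R := R) connT (phi g w) (phi (g * h)%g (node z)).
  apply: leq_trans nodes _; rewrite (_ : 16 = 14 + 2)%N // leq_add2r.
  apply: leq_trans (q_le _ _) _; rewrite -actM act_dist.
  apply: leq_trans (q_ge _ _) _; rewrite rK.
  have := @node_vertex R _ connT (phi h (node z)); rewrite -/w /phi; lia.
move=> z; exists (2 * 13%:R + 6) => w.
have [g zw] := cobounded (r (node z)) (r (node w)); exists g.
apply: (near _ _ 2%N) => //; rewrite distC /extend.
apply: (leq_trans (dist_triangle connT (phi g (node z)) _ _)).
apply: (@leq_add _ _ 1 1); first exact: node_vertex.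
by rewrite -[X in dist _ _ X](rK (node w)); apply: leq_trans (q_le _ _) (dist_step _ zw).
Qed.

(** * Topology of the complex *)

Section CellTopology.
Context {R : realType} {G : groupType} {P : tri_presentation G}.
Implicit Types (c : G * cell_orbit P) (h : G).

Definition cell_pt c (x : set_type (simplex R (cell_dim c.2))) : complex R P :=
  \pi_(complex R P) (existT _ c x).

Lemma cell_pt_surj (z : complex R P) : exists c x, z = @cell_pt c x.
Proof. by rewrite -(reprK z); case: (repr z) => c x; exists c, x. Qed.

Lemma cell_pt_continuous c : continuous (@cell_pt c).
Proof.
move=> x; apply: (@continuous_comp _ _ _ (existT _ c) (\pi_(complex R P))).
  exact: existT_continuous.
exact: pi_continuous.
Qed.

Lemma closed_complex (A : set (complex R P)) :
  (forall c, closed (@cell_pt c @^-1` A)) -> closed A.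
Proof.
move=> cA; rewrite -openC.
apply/sigT_openP => c; have /closed_openC := cA c; exact.
Qed.

Lemma continuous_complex (T : topologicalType) (f : complex R P -> T) :
  (forall c, continuous (f \o @cell_pt c)) -> continuous f.
Proof.
move=> cf; apply/continuousP => A oA.
apply/sigT_openP => c; by have /continuousP/(_ A oA) := cf c.
Qed.

Lemma act_continuous h : continuous (@complex_act R G P h).
Proof.
apply: continuous_complex => -[g o] x.
have -> : complex_act h \o @cell_pt (g, o) = @cell_pt ((h * g)%g, o).
  by apply/funext => y /=; rewrite /cell_pt act_pi.
exact: cell_pt_continuous.
Qed.

Lemma act_comp h1 h2 (z : complex R P) :
  complex_act h1 (complex_act h2 z) = complex_act (h1 * h2)%g z.
Proof.
have [[g o] [x ->]] := cell_pt_surj z.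
by rewrite /cell_pt !act_pi /act_cells /pt/= mulgA.
Qed.

Lemma act1 (z : complex R P) : complex_act 1%g z = z.
Proof.
have [[g o] [x ->]] := cell_pt_surj z.
by rewrite /cell_pt !act_pi /act_cells /pt/= mul1g.
Qed.

End CellTopology.

Section Segment.
Context {R : realType} {n : nat}.

Lemma simplex_conv (x y : 'rV[R]_n.+1) (t : R) : simplex R n x -> simplex R n y ->
  0 <= t <= 1 -> simplex R n ((1 - t) *: x + t *: y).
Proof.
move=> [x0 x1] [y0 y1] /andP[t0 t1]; split.
  by move=> j; rewrite !mxE addr_ge0 ?mulr_ge0 // subr_ge0.
under eq_bigr do rewrite !mxE.
by rewrite big_split /= -!mulr_sumr x1 y1 !mulr1 subrK.
Qed.

(** Clamping the parameter makes [segment_pt] continuous on the whole line. *)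
Definition clamp (t : R) : R := Num.max 0 (Num.min 1 t).

Lemma clamp01 t : 0 <= clamp t <= 1.
Proof. by rewrite /clamp le_max lexx /= ge_max ler01 ge_min lexx. Qed.

Lemma clamp_id t : 0 <= t <= 1 -> clamp t = t.
Proof. by move=> /andP[t0 t1]; rewrite /clamp min_r // max_r. Qed.

Lemma clamp_continuous : continuous clamp.
Proof.
move=> t; apply: (@continuous_max R R (cst 0) (fun t => Num.min 1 t)).
  exact: cvg_cst.
by apply: (@continuous_min R R (cst 1) id); [exact: cvg_cst|exact: cvg_id].
Qed.

Definition segment_pt (x y : set_type (simplex R n)) (t : R) : set_type (simplex R n) :=
  SigSub (mem_set (simplex_conv (set_mem (valP x)) (set_mem (valP y)) (clamp01 t))).

Lemma segment_pt_continuous x y : continuous (segment_pt x y).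
Proof.
apply: continuous_comp_initial => t /=.
apply: (@cvgD _ 'rV[R]_n.+1).
  apply: cvgZr_tmp; apply: cvgB; first exact: cvg_cst.
  exact: clamp_continuous.
by apply: cvgZr_tmp; exact: clamp_continuous.
Qed.

Lemma segment_pt0 x y : segment_pt x y 0 = x.
Proof. by apply: val_inj; rewrite /= clamp_id ?lexx ?ler01 // subr0 scale1r scale0r addr0. Qed.

Lemma segment_pt1 x y : segment_pt x y 1 = y.
Proof. by apply: val_inj; rewrite /= clamp_id ?lexx ?ler01 // subrr scale1r scale0r add0r. Qed.

End Segment.

Section Corners.
Context {R : realType} {G : groupType} {P : tri_presentation G}.
Implicit Types (c : G * cell_orbit P) (h : G).

Lemma simplex_delta n (j : 'I_n.+1) : simplex R n (delta_mx ord0 j).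
Proof.
split; first by move=> k; rewrite mxE /=; case: (_ == _).
rewrite (bigD1 j) //= big1 ?mxE ?eqxx ?addr0 // => k kj.
by rewrite mxE (negPf kj) andbF.
Qed.

Definition corner_pt n (j : 'I_n.+1) : set_type (simplex R n) :=
  SigSub (mem_set (simplex_delta j)).

Definition vertex_pt (g : G) : complex R P :=
  @cell_pt _ _ _ (g, Vertex P) (corner_pt ord0).

Lemma corner_edge0 (a : G) (s : gens P) : corner (a, Edge s) 0 = a.
Proof. by rewrite /corner /= mulg1. Qed.

Lemma corner_edge1 (a : G) (s : gens P) : corner (a, Edge s) 1 = (a * gen s)%g.
Proof. by rewrite /corner /= /letter_val /= mulg1. Qed.

Lemma glue_eq (p q : cells R P) : Defs.glue p q ->
  \pi_(complex R P) p = \pi_(complex R P) q.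
Proof. by move=> pq; apply/eqmodP/asboolP/rst_step. Qed.

Lemma edge_corner_pt (a : G) (s : gens P) (j : 'I_2) :
  @cell_pt R _ _ (a, Edge s) (corner_pt j) = vertex_pt (corner (a, Edge s) j).
Proof. by apply: glue_eq; exact: GlueEnd. Qed.

(** Together with [side_gen], the edge to which the side of a triangle from
    corner [i] to corner [i + 1] is glued. *)
Definition side_base (g : G) (r : {r : 3.-tuple (gens P * bool) | r \in rels P})
    (i : 'I_3) : G :=
  if (tnth (val r) i).2 then corner (g, Triangle r) i
  else corner (g, Triangle r) (ordS i).

Definition side_gen (r : {r : 3.-tuple (gens P * bool) | r \in rels P})
    (i : 'I_3) : gens P := (tnth (val r) i).1.

Lemma side_corners (g : G) r (i : 'I_3) :
  (corner (g, Triangle r) i, corner (g, Triangle r) (ordS i)) =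
  if (tnth (val r) i).2 then (side_base g r i, (side_base g r i * gen (side_gen r i))%g)
  else ((side_base g r i * gen (side_gen r i))%g, side_base g r i).
Proof.
have := cornerS (c := (g, Triangle r)) i (erefl : boundary_word (Triangle r) = val r) (valP r).
rewrite /side_base /side_gen /letter_val; case: ifP => _ -> //.
by rewrite mulgVK.
Qed.

Definition subcell (c' c : G * cell_orbit P) : Prop :=
  forall y, exists x, @cell_pt R _ _ c' y = @cell_pt R _ _ c x.

Lemma edge_coordinates (y : set_type (simplex R 1)) :
  set_val y = (1 - set_val y ord0 ord_max) *: delta_mx ord0 ord0
              + set_val y ord0 ord_max *: delta_mx ord0 ord_max /\
  0 <= set_val y ord0 ord_max <= 1.
Proof.
have /set_mem[y0] := valP y; rewrite big_ord_recl big_ord1 => y1.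
have l1 : lift ord0 ord0 = ord_max :> 'I_2 by apply: val_inj.
rewrite l1 in y1; split; last by rewrite y0 /= -y1 lerDr y0.
apply/rowP => j; rewrite !mxE /=; case: (unliftP ord0 j) => [k|] ->.
  by rewrite ord1 l1 /= mulr0 mulr1 add0r.
by rewrite mulr1 mulr0 addr0 -y1 addrK.
Qed.

Lemma side_subcell (g : G) r (i : 'I_3) :
  subcell (side_base g r i, Edge (side_gen r i)) (g, Triangle r).
Proof.
move=> y; have [yE t01] := edge_coordinates y.
set t := set_val y ord0 ord_max in yE t01.
set l := tnth (val r) i.
pose t' := if l.2 then t else 1 - t.
have t'01 : 0 <= t' <= 1 by rewrite /t'; case: ifP => _ //; lra.
have sx := simplex_conv (simplex_delta i) (simplex_delta (ordS i)) t'01.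
exists (SigSub (mem_set sx)); apply/esym/glue_eq.
apply: (@GlueSide _ _ _ g r i t') => //.
rewrite [LHS]yE /t' -/l; case: ifP => _ //.
by rewrite subKr addrC.
Qed.

Lemma triangle_corner_pt (g : G) r (i : 'I_3) :
  @cell_pt R _ _ (g, Triangle r) (corner_pt i) = vertex_pt (corner (g, Triangle r) i).
Proof.
set l := tnth (val r) i.
pose j : 'I_2 := if l.2 then ord0 else ord_max.
transitivity (@cell_pt R _ _ (side_base g r i, Edge (side_gen r i)) (corner_pt j)).
  apply: glue_eq; apply: (@GlueSide _ _ _ g r i 0).
    by rewrite subr0 scale1r scale0r addr0.
  by rewrite subr0 scale1r scale0r addr0.
rewrite edge_corner_pt; congr vertex_pt.
have := side_corners g r i; rewrite -/l /j; case: l.2 => /= -[-> _].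
  by rewrite corner_edge0.
by rewrite corner_edge1.
Qed.

Lemma cell_corner_pt c (j : 'I_(cell_dim c.2).+1) :
  @cell_pt R _ _ c (corner_pt j) = vertex_pt (corner c j).
Proof.
case: c j => g [|s|r] /= j.
- by rewrite ord1 /corner /= mulg1.
- exact: edge_corner_pt.
- exact: triangle_corner_pt.
Qed.

Definition edge_between c (a b : G) : Prop := exists e s,
  subcell (e, Edge s) c /\ (a = e /\ b = (e * gen s)%g \/ b = e /\ a = (e * gen s)%g).

Lemma edge_betweenC c a b : edge_between c a b -> edge_between c b a.
Proof. by move=> [e [s [sc ab]]]; exists e, s; split => //; case: ab; [right|left]. Qed.

Lemma side_edge_between (g : G) r (i : 'I_3) :
  edge_between (g, Triangle r) (corner (g, Triangle r) i) (corner (g, Triangle r) (ordS i)).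
Proof.
exists (side_base g r i), (side_gen r i); split; first exact: side_subcell.
by have := side_corners g r i; case: ifP => _ [-> ->]; [left|right].
Qed.

Lemma ord3_cases (j k : 'I_3) : [\/ j = k, k = ordS j | j = ordS k].
Proof.
by case: j => -[|[|[|//]]] ?; case: k => -[|[|[|//]]] ?;
  [constructor 1|constructor 2|constructor 3|constructor 3|constructor 1
  |constructor 2|constructor 2|constructor 3|constructor 1]; apply: val_inj.
Qed.

(** Cells have at most three corners, so any two of them span a side. *)
Lemma corners_adjacent c (j k : 'I_(cell_dim c.2).+1) :
  corner c j = corner c k \/ edge_between c (corner c j) (corner c k).
Proof.
case: c j k => g [|s|r] /= j k.
- by left; rewrite !ord1.
- have sub0 : subcell (g, Edge s) (g, Edge s) by move=> y; exists y.
  case: j k => -[|[|//]] ? [[|[|//]] ?] /=; try (by left); right; exists g, s; split => //.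
    by left; rewrite corner_edge0 corner_edge1.
  by right; rewrite corner_edge0 corner_edge1.
- case: (ord3_cases j k) => [->|->|->]; first by left.
    by right; exact: side_edge_between.
  by right; exact/edge_betweenC/side_edge_between.
Qed.

End Corners.

(** * Heights *)

Section Heights.
Context {R : realType} {G : groupType} {P : tri_presentation G} (F : G -> R).
Implicit Types (c : G * cell_orbit P) (h : G) (lo hi : R).

Definition cell_height c (x : set_type (simplex R (cell_dim c.2))) : R :=
  \sum_j set_val x ord0 j * F (corner c j).
Arguments cell_height : clear implicits.

Lemma height_cell_pt c x : height F (cell_pt x) = cell_height c x.
Proof. exact: height_pi. Qed.

Lemma cell_height_continuous c : continuous (cell_height c).
Proof.
pose g (v : 'rV[R]_(cell_dim c.2).+1) : R := \sum_j v ord0 j * F (corner c j).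
have g_cont : continuous g.
  apply: continuous_big; first exact: (@add_continuous R^o).
  move=> j _ v.
  apply: (@continuousM _ _ (fun v : 'rV[R]_(cell_dim c.2).+1 => v ord0 j) (cst _)).
    exact: coord_continuous.
  exact: cst_continuous.
suff : continuous (g \o set_val : set_type (simplex R (cell_dim c.2)) -> R) by [].
move=> x; apply: continuous_comp; last exact: g_cont.
exact: initial_continuous.
Qed.

Lemma cell_height_ge c x lo : (forall j : 'I_(cell_dim c.2).+1, lo <= F (corner c j)) ->
  lo <= cell_height c x.
Proof.
move=> loF; have /set_mem[x0 x1] := valP x.
rewrite -[lo]mul1r -x1 mulr_suml; apply: ler_sum => j _.
exact: ler_wpM2l.
Qed.

Lemma cell_height_le c x hi : (forall j : 'I_(cell_dim c.2).+1, F (corner c j) <= hi) ->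
  cell_height c x <= hi.
Proof.
move=> Fhi; have /set_mem[x0 x1] := valP x.
rewrite -[hi]mul1r -x1 mulr_suml; apply: ler_sum => j _.
exact: ler_wpM2l.
Qed.

Lemma cell_height_segment c x y t : 0 <= t <= 1 ->
  cell_height c (segment_pt x y t) = (1 - t) * cell_height c x + t * cell_height c y.
Proof.
move=> t01; rewrite /cell_height !mulr_sumr -big_split /=; apply: eq_bigr => j _.
by rewrite /set_val /= clamp_id // !mxE mulrDl !mulrA.
Qed.

Lemma cell_height_corner c j : cell_height c (corner_pt j) = F (corner c j).
Proof.
rewrite /cell_height (bigD1 j) //= big1 ?mxE ?eqxx ?mul1r ?addr0 // => k kj.
by rewrite mxE (negPf kj) andbF mul0r.
Qed.

Lemma height_vertex (a : G) : height F (vertex_pt a : complex R P) = F a.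
Proof. by rewrite height_cell_pt cell_height_corner /corner /= mulg1. Qed.

Definition between lo hi : set (complex R P) := [set z | lo <= height F z <= hi].

Lemma height_continuous : continuous (height F : complex R P -> R).
Proof.
apply: continuous_complex => c.
have -> : height F \o @cell_pt R G P c = cell_height c.
  by apply/funext => x; exact: height_cell_pt.
exact: cell_height_continuous.
Qed.

Lemma closed_between lo hi : closed (between lo hi).
Proof.
have -> : between lo hi = height F @^-1` [set y | lo <= y] `&` height F @^-1` [set y | y <= hi].
  by apply/seteqP; split=> z /= => [/andP|[? ?]]; last apply/andP.
by apply: closedI; apply: preimage_closed => [? _|]; first exact: height_continuous;
  [exact: closed_ge|exact: height_continuous|exact: closed_le].
Qed.

Definition linked lo hi (z z' : complex R P) : Prop :=
  connected_component (between lo hi) z z'.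

Lemma linkedC lo hi z z' : linked lo hi z z' -> linked lo hi z' z.
Proof. exact: connected_component_sym. Qed.

Lemma linked_trans lo hi y x z : linked lo hi x y -> linked lo hi y z -> linked lo hi x z.
Proof. exact: connected_component_trans. Qed.

Lemma connected_component_mono (T : topologicalType) (A B : set T) x :
  A `<=` B -> connected_component A x `<=` connected_component B x.
Proof. by move=> AB y [C [Cx CA cC] Cy]; exists C => //; split => //; exact: subset_trans AB. Qed.

Lemma linkedW lo hi lo' hi' z z' : lo' <= lo -> hi <= hi' ->
  linked lo hi z z' -> linked lo' hi' z z'.
Proof.
move=> ll hh; apply: connected_component_mono => w /andP[lw wh].
by apply/andP; split; [exact: le_trans lw|exact: le_trans hh].
Qed.

(** A slice of a cell is convex. *)
Lemma linked_cell c x y lo hi : lo <= cell_height c x <= hi ->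
  lo <= cell_height c y <= hi -> linked lo hi (cell_pt x) (cell_pt y).
Proof.
move=> /andP[lx xh] /andP[ly yh].
exists ((fun t => cell_pt (segment_pt x y t)) @` `[0, 1]).
  split.
  - by exists 0; rewrite ?segment_pt0 //= in_itv /= lexx ler01.
  - move=> _ /= [t + <-]; rewrite in_itv /= => t01.
    rewrite /between /= height_cell_pt cell_height_segment //.
    by case/andP: t01 => t0 t1; apply/andP; split; nra.
  - apply: connected_continuous_connected; first exact: segment_connected.
    apply: continuous_subspaceT => t.
    apply: (@continuous_comp _ _ _ (segment_pt x y) (@cell_pt R G P c)).
      exact: segment_pt_continuous.
    exact: cell_pt_continuous.
by exists 1; rewrite ?segment_pt1 //= in_itv /= lexx ler01.
Qed.

End Heights.
Arguments cell_height {R G P} F c x.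

(** The properties of the rescaled pseudocharacter on which the geometry rests.
    The bounds on the generators give [2 * D < 1 / 4], and together with the
    bound on the defect they make the corners of a cell differ in height by
    less than [1 / 4]. *)
Record fine_pseudocharacter {R : realType} {G : groupType} (P : tri_presentation G)
    (F : G -> R) (D : R) : Prop := FinePseudocharacter {
  fine_defect : forall a b, `|F a + F b - F (a * b)%g| <= D;
  fine_gen : forall s : gens P, `|F (gen s)| + D < 1 / 4;
  fineV : forall a, F (a^-1)%g = - F a;
  fine_half : forall a (n : int), F a <> n%:~R + 1 / 2;
  fine_ascend : exists s : gens P, D < F (gen s) }.

Section Fine.
Context {R : realType} {G : groupType} {P : tri_presentation G} {F : G -> R} {D : R}
  (fineF : fine_pseudocharacter P F D).
Implicit Types (c : G * cell_orbit P) (h : G) (lo hi : R).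

Lemma fine1 : F 1%g = 0.
Proof. by have := fineV fineF 1%g; rewrite invg1 => F1; lra. Qed.

Lemma fineD_small : 2 * D < 1 / 4.
Proof.
have [s Ds] := fine_ascend fineF.
by have := fine_gen fineF s; have := ler_norm (F (gen s)); lra.
Qed.

Lemma gen_step a (s : gens P) : `|F (a * gen s)%g - F a| < 1 / 4.
Proof.
have := fine_defect fineF a (gen s); have := fine_gen fineF s.
move: (F _) (F (gen s)) (F a) => y x z xD; rewrite !ler_norml !ltr_norml => /andP[].
by have := ler_norm x; have := ler_norm (- x); rewrite normrN => *; apply/andP; split; lra.
Qed.

Lemma corners_close c (j k : 'I_(cell_dim c.2).+1) :
  `|F (corner c j) - F (corner c k)| < 1 / 4.
Proof.
case: (@corners_adjacent R _ _ c j k) => [->|]; first by rewrite subrr normr0; lra.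
move=> [e [s [_ [[-> ->]|[-> ->]]]]]; last exact: gen_step.
by rewrite distrC; exact: gen_step.
Qed.

(** The extreme heights on a cell are attained at corners. *)
Lemma cell_height_close c x (j : 'I_(cell_dim c.2).+1) :
  `|cell_height F c x - F (corner c j)| < 1 / 4.
Proof.
have [k _ kmax] := @arg_maxP _ _ _ j predT (fun k : 'I_(cell_dim c.2).+1 => F (corner c k)) isT.
have [l _ lmin] := @arg_minP _ _ _ j predT (fun k : 'I_(cell_dim c.2).+1 => F (corner c k)) isT.
have := @cell_height_le _ _ _ F c x _ (fun i => kmax i isT).
have := @cell_height_ge _ _ _ F c x _ (fun i => lmin i isT).
have := corners_close k j; have := corners_close l j.
by rewrite !ltr_norml => /andP[? ?] /andP[? ?] *; apply/andP; split; lra.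
Qed.

Lemma corner_le c x : exists j : 'I_(cell_dim c.2).+1, F (corner c j) <= cell_height F c x.
Proof.
have [l _ lmin] := @arg_minP _ _ _ ord0 predT (fun k : 'I_(cell_dim c.2).+1 => F (corner c k)) isT.
by exists l; apply: cell_height_ge => j; exact: lmin.
Qed.

Lemma corner_ge c x : exists j : 'I_(cell_dim c.2).+1, cell_height F c x <= F (corner c j).
Proof.
have [l _ lmax] := @arg_maxP _ _ _ ord0 predT (fun k : 'I_(cell_dim c.2).+1 => F (corner c k)) isT.
by exists l; apply: cell_height_le => j; exact: lmax.
Qed.

Definition level (n : int) (y : R) : Prop := `|y - n%:~R| < 1 / 2.

(** If the lowest corner is below [n - 1 / 2] and the highest one above
    [n + 1 / 2], the corners are too far apart; no corner lies on these heights. *)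
Lemma corner_level c x (n : int) : `|cell_height F c x - n%:~R| <= 1 / 2 ->
  exists j : 'I_(cell_dim c.2).+1, level n (F (corner c j)).
Proof.
rewrite ler_norml => /andP[lh hh].
have [j jh] := corner_le x; have [k hk] := corner_ge x.
have := corners_close k j; rewrite ltr_norml => /andP[_ kj].
have lt_half (a : G) (m : int) : F a <= m%:~R + 1 / 2 -> F a < m%:~R + 1 / 2.
  by rewrite lt_neqAle => ->; rewrite andbT; apply/eqP/(fine_half fineF).
have gt_half (a : G) (m : int) : m%:~R + 1 / 2 <= F a -> m%:~R + 1 / 2 < F a.
  by rewrite lt_neqAle => ->; rewrite andbT eq_sym; apply/eqP/(fine_half fineF).
rewrite /level; have [Fk|Fk] := ltP (F (corner c k)) (n%:~R + 1 / 2).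
  exists k; rewrite ltr_norml; apply/andP; split; last lra.
  by have := @gt_half (corner c k) (n - 1); rewrite intrB; lra.
exists j; rewrite ltr_norml; apply/andP; split; first lra.
by have := @lt_half (corner c j) n; lra.
Qed.

(** The bound holds at the corners, and heights are affine on cells. *)
Lemma height_act h (z : complex R P) :
  `|height F (complex_act h z) - (F h + height F z)| <= D.
Proof.
have [[g o] [x ->]] := cell_pt_surj z.
have -> : complex_act h (cell_pt x) = @cell_pt R _ P ((h * g)%g, o) x.
  by rewrite /cell_pt act_pi.
rewrite !height_cell_pt /cell_height /=.
have /set_mem[x0 x1] := valP x.
rewrite -[F h]mul1r -x1 mulr_suml -big_split /= -sumrB.
apply: le_trans (ler_norm_sum _ _ _) _.
rewrite -[D]mul1r -x1 mulr_suml; apply: ler_sum => j _.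
rewrite -mulrDr -mulrBr normrM ger0_norm //; apply: ler_wpM2l => //.
have -> : corner ((h * g)%g, o) j = (h * corner (g, o) j)%g by rewrite /corner /= mulgA.
by rewrite distrC; exact: (fine_defect fineF).
Qed.

Lemma cell_height_ivt c x y v : cell_height F c x <= v <= cell_height F c y ->
  exists z, cell_height F c z = v.
Proof.
move=> /andP[xv vy]; have [xy|xy] := eqVneq (cell_height F c x) (cell_height F c y).
  by exists x; lra.
have d0 : 0 < cell_height F c y - cell_height F c x.
  by rewrite subr_gt0 lt_neqAle xy; exact: le_trans vy.
pose t := (v - cell_height F c x) / (cell_height F c y - cell_height F c x).
have t01 : 0 <= t <= 1.
  rewrite /t ler_pdivrMr // mul1r lerB // andbT.
  by apply: divr_ge0; [rewrite subr_ge0|exact: ltW].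
exists (segment_pt x y t); rewrite cell_height_segment //.
have : t * (cell_height F c y - cell_height F c x) = v - cell_height F c x.
  by rewrite /t mulfVK // gt_eqF.
nra.
Qed.

Lemma linked_edge a (s : gens P) lo hi x j : lo <= cell_height F (a, Edge s) x <= hi ->
  lo <= F (corner (a, Edge s) j) <= hi -> (j < 2)%N ->
  linked F lo hi (vertex_pt (corner (a, Edge s) j)) (cell_pt x).
Proof.
move=> hx hj j2.
rewrite -(edge_corner_pt a s (Ordinal j2)).
by apply: linked_cell => //; rewrite cell_height_corner.
Qed.

(** Right multiplication by a generator [s] with [D < F s] raises heights by at
    least [F s - D], so the vertices [a s^k] climb past every height, and the
    path through them crosses [n + 1 / 2] without ever going below [a]. *)
Lemma ascent a (n : int) : F a < n%:~R + 2^-1 ->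
  exists2 z : complex R P, height F z = n%:~R + 2^-1 &
    linked F (F a) (n%:~R + 2^-1) (vertex_pt a) z.
Proof.
have [s Ds] := fine_ascend fineF; set v := _ + _.
have up b : F b + (F (gen s) - D) <= F (b * gen s)%g.
  by have := fine_defect fineF b (gen s); rewrite ler_norml => /andP[_]; lra.
have [k] : exists k : nat, v < F a + k%:R * (F (gen s) - D).
  have d0 : 0 < F (gen s) - D by lra.
  exists (Num.bound (`|v - F a| / (F (gen s) - D))).
  have := archi_boundP (divr_ge0 (normr_ge0 (v - F a)) (ltW d0)).
  by rewrite ltr_pdivrMr //; have := ler_norm (v - F a); lra.
elim: k a => [|k IH] a; first by rewrite mul0r addr0 => /ltW/le_gtF->.
rewrite -natr1 mulrDl mul1r => kv av.
have upa := up a; have [vas|asv] := leP v (F (a * gen s)%g).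
  have [x xv] : exists x, cell_height F (a, Edge s) x = v.
    apply: (@cell_height_ivt (a, Edge s) (corner_pt ord0) (corner_pt ord_max)).
    by rewrite !cell_height_corner corner_edge0 corner_edge1 (ltW av).
  exists (cell_pt x); first by rewrite height_cell_pt.
  rewrite -{2}(corner_edge0 a s); apply: linked_edge => //.
    by rewrite xv lexx andbT ltW.
  by rewrite corner_edge0 lexx ltW.
have [|z zv lz] := IH (a * gen s)%g _ asv; first lra.
exists z => //; apply: (@linked_trans _ _ _ _ _ _ (vertex_pt (a * gen s)%g)).
  rewrite -{2}(corner_edge0 a s) -[X in linked _ _ _ _ (vertex_pt X)](corner_edge1 a s).
  rewrite -(edge_corner_pt a s ord_max).
  apply: linked_edge => //; first by rewrite cell_height_corner corner_edge1 (ltW asv) andbT; lra.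
  by rewrite corner_edge0 lexx ltW.
by apply: linkedW lz => //; lra.
Qed.

End Fine.

(** * Integration of mod 2 cochains *)

Lemma component_eq (T : topologicalType) (A C : set T) z :
  components A C -> C z -> C = connected_component A z.
Proof. by move=> [x _ ->] /same_connected_component. Qed.

Section Words.
Context {G : groupType} {P : tri_presentation G}.
Notation val_of := (word_val (@gen G P)).

Lemma word_val_cat u v : val_of (u ++ v) = (val_of u * val_of v)%g.
Proof. by elim: u => [|l u IH] /=; rewrite ?mul1g // IH mulgA. Qed.

Context (d : G -> gens P -> bool).

(** [d] is a mod 2 cochain, with [d g s] its value on the edge labelled [s] at
    [g]; an edge traversed backwards contributes the same value. *)
Definition letter_sum (g : G) (l : letter (gens P)) : bool :=
  if l.2 then d g l.1 else d (g * (gen l.1)^-1)%g l.1.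

Fixpoint word_sum (g : G) (w : seq (letter (gens P))) : bool :=
  if w is l :: w' then letter_sum g l (+) word_sum (g * letter_val (@gen G P) l)%g w'
  else false.

Lemma word_sum_cat g u v :
  word_sum g (u ++ v) = word_sum g u (+) word_sum (g * val_of u)%g v.
Proof.
elim: u g => [|l u IH] g /=; first by rewrite mulg1.
by rewrite IH addbA mulgA.
Qed.

(** Simple connectedness of the complex: summing a cocycle along a word from [1]
    is invariant under the moves between words of equal value. *)
Lemma cochain_primitive :
  (forall g (r : 3.-tuple (gens P * bool)), r \in rels P -> word_sum g r = false) ->
  exists phi : G -> bool, forall g s, phi (g * gen s)%g = phi g (+) d g s.
Proof.
move=> d_rel.
have d_move u v : word_move (rels P) u v -> forall g, word_sum g u = word_sum g v.
  case=> [{}u {}v s e|{}u {}v r rP] g; last first.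
    by rewrite !word_sum_cat d_rel // addFb (word_val_rel rP) mulg1.
  rewrite !(word_sum_cat g) /=; congr (_ (+) _); rewrite addbA.
  have -> : (g * val_of u * letter_val (@gen G P) (s, e) *
             letter_val (@gen G P) (s, ~~ e))%g = (g * val_of u)%g.
    by case: e; rewrite /letter_val /= ?mulgK ?mulgVK.
  rewrite -[RHS]addFb; congr (_ (+) _).
  by case: e; rewrite /letter_sum /letter_val /= ?mulgK addbb.
have d_equiv u v : clos_refl_sym_trans _ (word_move (rels P)) u v ->
    word_sum 1%g u = word_sum 1%g v.
  elim=> [? ? /d_move//|//|? ? _ ->//|? ? ? _ -> _ //].
pose word g := projT1 (cid (@gen_surj G P g)).
have wordE g : val_of (word g) = g by rewrite /word; case: cid.
exists (fun g => word_sum 1%g (word g)) => g s.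
have -> : word_sum 1%g (word (g * gen s)%g) = word_sum 1%g (word g ++ [:: (s, true)]).
  apply/d_equiv/gen_rels.
  by rewrite word_val_cat !wordE /= /letter_val /= mulg1.
by rewrite word_sum_cat wordE /= mul1g addbF.
Qed.

End Words.

Section Tracks.
Context {R : realType} {G : groupType} {P : tri_presentation G} {F : G -> R} {D : R}
  (fineF : fine_pseudocharacter P F D).
Implicit Types (c : G * cell_orbit P).

Definition lev (a : G) : int := Num.floor (F a + 1 / 2).

Lemma levP a : level (lev a) (F a).
Proof.
rewrite /level /lev; have := floor_itv (F a + 1 / 2).
set n := Num.floor _; rewrite intrD => /andP[n1 n2].
rewrite ltr_norml; apply/andP; split; last by lra.
rewrite ltrBrDr lt_neqAle; apply/andP; split; last by lra.
by apply/eqP => E; case: (@fine_half _ _ _ _ _ fineF a (n - 1)); rewrite intrB; lra.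
Qed.

Lemma int_close (m n : int) : `|m%:~R - n%:~R : R| < 1 -> m = n.
Proof.
rewrite -intrB -intr_norm -[1](mulr1z 1) ltr_int => mn1.
by apply/eqP; rewrite -subr_eq0 -normr_eq0; move: (normr_ge0 (m - n)) mn1; lia.
Qed.

Lemma lev_level a (n : int) : level n (F a) -> lev a = n.
Proof.
move: (levP a); rewrite /level !ltr_norml => /andP[? ?] /andP[? ?].
by apply: int_close; rewrite ltr_norml; apply/andP; split; lra.
Qed.

Lemma lev_lt a b : (lev a < lev b)%R -> F a <= (lev a)%:~R + 2^-1 <= F b.
Proof.
move=> ab; have : (lev a)%:~R + 1 <= (lev b)%:~R :> R.
  by rewrite -[1](mulr1z 1) -intrD ler_int; lia.
move: (levP a) (levP b); rewrite /level !ltr_norml => /andP[? ?] /andP[? ?] ?.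
by apply/andP; split; lra.
Qed.

Lemma lev_close a b : `|F a - F b| < 1 / 4 -> `|lev a - lev b| <= 1.
Proof.
move: (levP a) (levP b); rewrite /level !ltr_norml => /andP[? ?] /andP[? ?] /andP[? ?].
rewrite ler_norml; apply/andP; split; rewrite -ltzD1 -?(@ltr_int R) !(intrD,intrB,mulrNz) /=; lra.
Qed.

(** Heights on a cell differ by less than [1 / 2]. *)
Lemma half_height_cell c x y (m n : int) :
  cell_height F c x = m%:~R + 2^-1 -> cell_height F c y = n%:~R + 2^-1 -> m = n.
Proof.
have := cell_height_close fineF x ord0; have := cell_height_close fineF y ord0.
move=> + + xm yn; rewrite xm yn !ltr_norml => /andP[? ?] /andP[? ?].
by apply: int_close; rewrite ltr_norml; apply/andP; split; lra.
Qed.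

Definition cell_meets c (T : set (complex R P)) : Prop := exists x, T (@cell_pt R _ _ c x).

(** A cell meets only one half-integer height, in a convex slice. *)
Lemma track_cell (T : set (complex R P)) c x y (n : int) :
  components (@half_level R G P F) T -> T (@cell_pt _ _ _ c x) ->
  cell_height F c y = n%:~R + 2^-1 -> T (@cell_pt _ _ _ c y).
Proof.
move=> cT Tx yn; rewrite (component_eq cT Tx).
have [m] : @half_level R G P F (cell_pt x).
  by case: cT Tx => z _ -> /connected_component_sub.
rewrite height_cell_pt => xm; have mn := half_height_cell xm yn.
have : linked F (n%:~R + 2^-1) (n%:~R + 2^-1) (cell_pt x) (cell_pt y).
  by apply: linked_cell; rewrite ?xm ?yn ?mn lexx.
apply: connected_component_mono => w; rewrite /between /= -eq_le => /eqP wn.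
by exists n; rewrite wn.
Qed.

Lemma corners_crossing c (j k : 'I_(cell_dim c.2).+1) :
  lev (corner c j) != lev (corner c k) ->
  exists x (n : int), cell_height F c x = n%:~R + 2^-1.
Proof.
wlog jk : j k / (lev (corner c j) < lev (corner c k)).
  by move=> W jk; case: (ltgtP (lev (corner c j)) (lev (corner c k))) (jk) => // ? _;
    [exact: (W j k)|apply: (W k j); rewrite // eq_sym].
have /andP[h1 h2] := lev_lt jk.
have [x xE] := @cell_height_ivt _ _ _ F c (corner_pt j) (corner_pt k)
  ((lev (corner c j))%:~R + 2^-1)
  ltac:(by rewrite !cell_height_corner h1).
by exists x, (lev (corner c j)).
Qed.

Context {T : set (complex R P)} (cT : components (@half_level R G P F) T).

(** A side that changes level crosses the half-integer slice of the cell. *)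
Lemma meets_edge c a (s : gens P) : @subcell R _ _ (a, Edge s) c ->
  lev a != lev (a * gen s)%g -> `[< cell_meets (a, Edge s) T >] = `[< cell_meets c T >].
Proof.
move=> sub as_lev; apply/asboolP/asboolP => -[x Tx].
  by have [y xy] := sub x; exists y; rewrite -xy.
have [|y [n yn]] := @corners_crossing (a, Edge s) ord0 ord_max.
  by rewrite corner_edge0 corner_edge1.
have [z yz] := sub y; exists y; rewrite yz.
by apply: (track_cell cT Tx (n := n)); rewrite -height_cell_pt -yz height_cell_pt.
Qed.

Definition crosses (a : G) (s : gens P) : bool :=
  (lev a != lev (a * gen s)%g) && `[< cell_meets (a, Edge s) T >].

(** By [meets_edge], either all sides that change level cross the track, or
    none does; as the three corners have at most two levels, the number of
    sides that change level is even. *)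
Lemma triangle_crossings g r : r \in rels P -> word_sum crosses g r = false.
Proof.
move=> rP; pose r' : {r : 3.-tuple (gens P * bool) | r \in rels P} := exist _ r rP.
pose k (i : 'I_3) := corner (g, Triangle r') i.
pose M := `[< cell_meets (g, Triangle r') T >].
have side (i : 'I_3) : letter_sum crosses (k i) (tnth r i) =
    (lev (k i) != lev (k (ordS i))) && M.
  have := side_corners g r' i; rewrite -/(k i) -/(k (ordS i)) /side_base /side_gen /=.
  rewrite -/(k i) -/(k (ordS i)) /letter_sum.
  have sub := @side_subcell R _ _ g r' i.
  rewrite /side_base /side_gen /= -/(k i) -/(k (ordS i)) in sub.
  case: ifP sub => _ sub ends.
    have k'E := congr1 snd ends; rewrite /= in k'E.
    rewrite /crosses -k'E; case: eqVneq => //= ne.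
    by apply: meets_edge => //; rewrite -k'E.
  have kE := congr1 fst ends; rewrite /= in kE.
  rewrite kE mulgK eq_sym /crosses -kE; case: eqVneq => //= ne.
  by apply: meets_edge => //; rewrite -kE.
have k_next (i : 'I_3) : (k i * letter_val (@gen G P) (tnth r i))%g = k (ordS i).
  by rewrite /k (cornerS (c := (g, Triangle r')) i (erefl : boundary_word (Triangle r') = r)).
have close (i j : 'I_3) : `|lev (k i) - lev (k j)| <= 1.
  exact/lev_close/(corners_close fineF (c := (g, Triangle r'))).
have k0 : g = k ord0 by rewrite /k /corner /= take0 mulg1.
have rE : tval r = [:: tnth r ord0; tnth r (ordS ord0); tnth r (ordS (ordS ord0))].
  case: (r) => -[|a [|b [|d [|? ?]]]] //=.
have S3 : ordS (ordS (ordS ord0)) = ord0 :> 'I_3 by apply: val_inj.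
rewrite rE /= {1 2 3}k0 !k_next !side S3.
move: (close ord0 (ordS ord0)) (close (ordS ord0) (ordS (ordS ord0)))
  (close ord0 (ordS (ordS ord0))).
move: (lev _) (lev (k (ordS ord0))) (lev (k (ordS (ordS ord0)))) => x y z.
case: (M); rewrite ?andbF // !andbT.
by case: (eqVneq x y); case: (eqVneq y z); case: (eqVneq z x) => //=; lia.
Qed.

(** The cochain that counts crossings of the track [T] is a cocycle; its
    primitive tells on which side of [T] a vertex lies. *)
Lemma track_sides : exists phi : G -> bool,
  forall c (j k : 'I_(cell_dim c.2).+1), phi (corner c j) (+) phi (corner c k) =
    (lev (corner c j) != lev (corner c k)) && `[< cell_meets c T >].
Proof.
have [phi phiE] := cochain_primitive triangle_crossings.
exists phi => c j k; have [->|] := @corners_adjacent R _ _ c j k.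
  by rewrite addbb eqxx.
move: (corner c j) (corner c k) => a b [e [s [sub ab]]].
have : phi e (+) phi (e * gen s)%g = (lev e != lev (e * gen s)%g) && `[< cell_meets c T >].
  rewrite phiE addKb /crosses; case: eqVneq => //= ne; exact: meets_edge.
by case: ab => [[-> ->]|[-> ->]] //; rewrite addbC eq_sym.
Qed.

End Tracks.
Arguments lev {R G} F a.

(** * Sides of a track *)

Lemma connected_closed_split (T : topologicalType) (U A B : set T) :
  connected U -> closed A -> closed B -> U `<=` A `|` B -> U `&` (A `&` B) = set0 ->
  U `&` A !=set0 -> U `<=` A.
Proof.
move=> cU cA cB UAB dis UA.
have -> : U = U `&` A; last by move=> x [].
apply/esym/cU => //; last by exists A.
exists (~` B); first exact: closed_openC.
apply/seteqP; split => x [Ux h]; split => //.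
  by move=> Bx; have : (U `&` (A `&` B)) x by []; rewrite dis.
by case: (UAB x Ux).
Qed.

Section Sides.
Context {R : realType} {G : groupType} {P : tri_presentation G} {F : G -> R} {D : R}
  (fineF : fine_pseudocharacter P F D) {phi : G -> bool}
  (phi_lev : forall (c : G * cell_orbit P) (j k : 'I_(cell_dim c.2).+1),
    lev F (corner c j) = lev F (corner c k) -> phi (corner c j) = phi (corner c k)).
Implicit Types (c : G * cell_orbit P).

Definition cell_side c (n : int) : bool :=
  [exists j : 'I_(cell_dim c.2).+1, (lev F (corner c j) == n) && phi (corner c j)].

Lemma cell_side_corner c (n : int) (j : 'I_(cell_dim c.2).+1) :
  lev F (corner c j) = n -> cell_side c n = phi (corner c j).
Proof.
move=> jn; apply/existsP/idP => [[k /andP[/eqP kn]]|pj].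
  by rewrite (@phi_lev c k j) // kn.
by exists j; rewrite jn eqxx.
Qed.

(** The side of [z] as seen from the strip around the integer [n].  A point at
    half-integer height lies in two strips, and the two values may differ. *)
Definition side (n : int) (z : complex R P) : bool := cell_side (tag (repr z)) n.

Definition in_strip (n : int) (y : R) : bool := `|y - n%:~R| <= 1 / 2.

Lemma strip_corner c x (n : int) : in_strip n (cell_height F c x) ->
  exists j : 'I_(cell_dim c.2).+1, lev F (corner c j) = n.
Proof. by move=> /(corner_level fineF)[j /(lev_level fineF)]; exists j. Qed.

(** The corners of a face are corners of the cell, and one of them has level [n]. *)
Lemma glue_side (p q : cells R P) (n : int) : Defs.glue p q ->
  in_strip n (height_cells F q) -> cell_side (tag p) n = cell_side (tag q) n.
Proof.
move=> pq qn; have [j jn] : exists j : 'I_(cell_dim (tag q).2).+1, lev F (corner (tag q) j) = n.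
  by case: q qn {pq} => c x; exact: strip_corner.
have [k kj] : exists k : 'I_(cell_dim (tag p).2).+1, corner (tag p) k = corner (tag q) j.
  case: pq j {jn qn} => [g s i x y _|g r i t x y l c _ _] /= j.
    by exists i; rewrite ord1 [RHS]/corner /= mulg1.
  have := @side_corners _ _ g r i; rewrite /side_base /side_gen -/l -/c.
  case: j => -[|[|//]] ?; rewrite ?corner_edge0 ?corner_edge1.
    by case: ifP => _ _; [exists i|exists (ordS i)].
  case: ifP => lE; rewrite lE => e; first by exists (ordS i); exact: (congr1 snd e).
  by exists i; exact: (congr1 fst e).
by rewrite (cell_side_corner jn) (@cell_side_corner _ n k) kj.
Qed.

Lemma side_cell c x (n : int) : in_strip n (cell_height F c x) ->
  side n (@cell_pt _ _ _ c x) = cell_side c n.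
Proof.
move=> xn; have key (p q : cells R P) : clos_refl_sym_trans _ (@Defs.glue R G P) p q ->
    height_cells F p = height_cells F q /\
    (in_strip n (height_cells F q) -> cell_side (tag p) n = cell_side (tag q) n).
  elim=> [{}p {}q pq|//|{}p {}q _ [e IH]|{}p r {}q _ [e1 IH1] _ [e2 IH2]].
  - by split; [exact: height_glue|exact: glue_side].
  - by rewrite e; split => // qn; rewrite IH.
  - by split => [|qn]; [rewrite e1|rewrite IH1 ?IH2 // e2].
have [_] := key _ _ (repr_glued (existT _ c x : cells R P)).
exact.
Qed.

Lemma between_strip (n : int) (z : complex R P) :
  between F (n%:~R - 1 / 2) (n%:~R + 1 / 2) z = in_strip n (height F z).
Proof.
apply/propext; rewrite /between /in_strip /= ler_norml.
by split => /andP[? ?]; apply/andP; split; lra.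
Qed.

Notation strip n := (between (P:=P) F (n%:~R - 1 / 2) (n%:~R + 1 / 2)).

Lemma closed_strip_side (n : int) (b : bool) :
  closed [set z | strip n z /\ side n z = b].
Proof.
apply: closed_complex => c.
have [cb|cb] := eqVneq (cell_side c n) b.
  suff -> : @cell_pt _ _ _ c @^-1` [set z | strip n z /\ side n z = b] =
      @cell_pt _ _ _ c @^-1` strip n.
    apply: preimage_closed; last exact: closed_between.
    by move=> ? _; exact: cell_pt_continuous.
  apply/seteqP; split => x /= [] // xn; split => //.
  by move: xn; rewrite between_strip height_cell_pt => /side_cell ->.
suff -> : @cell_pt _ _ _ c @^-1` [set z | strip n z /\ side n z = b] = set0.
  exact: closed0.
apply/seteqP; split => x //= []; rewrite between_strip height_cell_pt => /side_cell -> e.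
by rewrite e eqxx in cb.
Qed.

(** On each cell, [side n] is constant in the strip. *)
Lemma side_connected (n : int) (U : set (complex R P)) z z' : connected U ->
  U `<=` strip n -> U z -> U z' -> side n z' = side n z.
Proof.
move=> cU Un Uz Uz'; set b := side n z.
have [] // := @connected_closed_split _ U _ _ cU (@closed_strip_side n b)
  (@closed_strip_side n (~~ b)) _ _ _ z' Uz'.
- move=> w Uw; case: (eqVneq (side n w) b) => wb; [left|right]; split => //; try exact: Un.
  by move: wb; case: (side n w) b => -[].
- by apply/seteqP; split => w //= [_ [[_ ->] [_]]]; case: b.
- by exists z; split => //; split => //; exact: Un.
Qed.

(** Closed half-spaces; a point at half-integer height lies in both if its two
    strips see different sides. *)
Definition half_space (b : bool) : set (complex R P) :=
  [set z | exists2 n : int, in_strip n (height F z) & side n z = b].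

Lemma half_cover z : half_space true z \/ half_space false z.
Proof.
have [c [x ->]] := cell_pt_surj z.
pose n := Num.floor (height F (cell_pt x) + 1 / 2).
have xn : in_strip n (height F (cell_pt x)).
  have := floor_itv (height F (cell_pt x) + 1 / 2).
  rewrite -/n intrD /in_strip ler_norml => /andP[? ?]; apply/andP; split; lra.
by case E : (side n (cell_pt x)); [left|right]; exists n.
Qed.

(** On a cell, a half-space is the union over the corners on its side of the
    points whose height is within [1 / 2] of the level of the corner. *)
Lemma closed_half b : closed (half_space b).
Proof.
apply: closed_complex => c.
pose A (j : 'I_(cell_dim c.2).+1) : set (set_type (simplex R (cell_dim c.2))) :=
  cell_height F c @^-1` [set y | (lev F (corner c j))%:~R - 1 / 2 <= y /\
    y <= (lev F (corner c j))%:~R + 1 / 2].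
suff -> : @cell_pt _ _ _ c @^-1` half_space b =
    \bigcup_(j in [set j : 'I_(cell_dim c.2).+1 | phi (corner c j) = b]) A j.
  apply: closed_bigcup => [|j _]; first exact: finite_finset.
  apply: preimage_closed; first by move=> ? _; exact: cell_height_continuous.
  by apply: closedI; [exact: closed_ge|exact: closed_le].
have stripE n y : in_strip n y <-> n%:~R - 1 / 2 <= y /\ y <= n%:~R + 1 / 2.
  rewrite /in_strip ler_norml; split => [/andP[? ?]|[? ?]]; last apply/andP; split; lra.
apply/seteqP; split => x /=.
  move=> [n xn]; rewrite height_cell_pt in xn; rewrite side_cell // => nb.
  have [j jn] := strip_corner xn; exists j; first by rewrite -nb (cell_side_corner jn).
  by rewrite /A /= jn; exact/stripE.
move=> [j jb /stripE xj]; exists (lev F (corner c j)); first by rewrite height_cell_pt.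
by rewrite side_cell // (@cell_side_corner _ _ j).
Qed.

End Sides.
Arguments side {R G P} F phi n z.
Arguments half_space {R G P} F phi b z.

(** * Separation by tracks *)

Section Geodesics.
Context {T : Type} (r : T -> T -> Prop).

Definition geodesic (N : nat) (e : nat -> T) : Prop :=
  (forall i, (i < N)%N -> r (e i) (e i.+1)) /\
  forall i j, (i <= N)%N -> (j <= N)%N -> r (e i) (e j) -> (j <= i.+1)%N.

(** A walk of minimal length has no shortcuts. *)
Lemma geodesic_exists x y : clos_refl_trans T r x y ->
  exists N e, [/\ geodesic N e, e 0 = x & e N = y].
Proof.
pose walk z N := exists e : nat -> T,
  [/\ forall i, (i < N)%N -> r (e i) (e i.+1), e 0%N = x & e N = z].
move=> /clos_rt_rtn1_iff xy.
have [N wN] : exists N, `[< walk y N >].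
  elim: xy => [|y' z yz _ [N /asboolP[e [we e0 eN]]]].
    by exists 0%N; apply/asboolP; exists (fun=> x); split=> // i; rewrite ltn0.
  exists N.+1; apply/asboolP; exists (fun i => if (i <= N)%N then e i else z).
  split=> [i||]; [|by rewrite leq0n|by rewrite ltnn].
  rewrite ltnS => iN; rewrite iN; case: ltnP => [|Ni]; first exact: we.
  by have -> : i = N by [lia]; rewrite eN.
have exN : exists N, (fun N => `[< walk y N >]) N by exists N.
have := ex_minnP exN; case=> {exN wN}N /asboolP[e [we e0 eN]] minN.
exists N, e; split=> //; split => // i j iN jN ij; rewrite leqNgt; apply/negP => ltij.
suff /minN : `[< walk y (N - (j - i.+1))%N >] by lia.
apply/asboolP; exists (fun k => if (k <= i)%N then e k else e (k + (j - i.+1))%N).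
split=> [k kN||]; [|by rewrite leq0n|]; last first.
  rewrite -eN; case: leqP => h; congr e; lia.
case: (leqP k i) => ki; case: (leqP k.+1 i) => k1i; try lia; first by apply: we; lia.
  have -> : k = i by lia.
  by have -> : (i.+1 + (j - i.+1) = j)%N by lia.
by rewrite addSn; apply: we; lia.
Qed.

End Geodesics.

Section Separation.
Context {R : realType} {G : groupType} {P : tri_presentation G} {F : G -> R} {D : R}
  (fineF : fine_pseudocharacter P F D).
Implicit Types (c : G * cell_orbit P).
Notation strip n := (between (P:=P) F (n%:~R - 1 / 2) (n%:~R + 1 / 2)).
Notation track T := (components (@half_level R G P F) T).

(** A connected set of half-integer heights has only one height. *)
Lemma track_height T z z' : track T -> T z -> T z' -> height F z' = height F z.
Proof.
move=> cT; have cnT : connected T by case: cT => w _ ->; exact: component_connected.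
have Thalf : T `<=` @half_level R G P F.
  by case: cT => w _ ->; exact: connected_component_sub.
wlog zz' : z z' / height F z < height F z'.
  move=> W Tz Tz'; case: (ltgtP (height F z) (height F z')) => // h.
    exact: (W z z').
  exact/esym/(W z' z).
move=> Tz Tz'; have [n zn] := Thalf z Tz.
pose A := [set w : complex R P | height F w <= n%:~R + 2^-1].
pose B := [set w : complex R P | n%:~R + 3 / 2 <= height F w].
have := @connected_closed_split _ T A B cnT.
have cA : closed A.
  by apply: (preimage_closed (D := [set y | y <= _])) => [? _|];
    [exact: height_continuous|exact: closed_le].
have cB : closed B.
  by apply: (preimage_closed (D := [set y | _ <= y])) => [? _|];
    [exact: height_continuous|exact: closed_ge].
move=> /(_ cA cB) TA; suff : A z' by rewrite /A /= -zn leNgt zz'.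
apply: TA => //; last by exists z; split => //; rewrite /A /= zn.
  move=> w /Thalf[m wm]; rewrite /A /B /= wm; case: (lerP m n) => [mn|nm]; [left|right].
    by rewrite lerD2r ler_int.
  have : (n + 1)%:~R <= m%:~R :> R by rewrite ler_int; lia.
  by rewrite intrD; lra.
by apply/seteqP; split => w //= [_ []]; rewrite /A /B /= => ? ?; lra.
Qed.

(** The half-spaces of [track_sides] overlap in [T] only.  Along [T], the two
    adjacent strips see different sides, and the side seen from a strip is
    constant on its components. *)
Lemma track_separates T : track T -> exists H : bool -> set (complex R P),
  [/\ forall b, closed (H b), H true `|` H false = setT, H true `&` H false `<=` T &
      forall (n1 n2 : int) C1 C2, n1 <> n2 ->
        components (strip n1) C1 -> components (strip n2) C2 ->
        T `<=` C1 -> T `<=` C2 -> exists b, C1 `<=` H b /\ C2 `<=` H (~~ b)].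
Proof.
move=> cT; have [phi phiE] := track_sides fineF cT.
have phi_lev (c : G * cell_orbit P) (j k : 'I_(cell_dim c.2).+1) :
    lev F (corner c j) = lev F (corner c k) -> phi (corner c j) = phi (corner c k).
  move=> jk; have := phiE c j k; rewrite jk eqxx /=.
  by case: (phi _) (phi _) => -[].
have half_at (y : R) (m n : int) : m <> n -> in_strip m y -> in_strip n y ->
    exists k : int, y = k%:~R + 2^-1.
  wlog mn : m n / m < n.
    move=> W mn; case: (ltgtP m n) => [?|?|//] ? ?; first exact: (W m n).
    by apply: (W n m) => // e; apply: mn.
  move=> _; rewrite /in_strip !ler_norml => /andP[_ ?] /andP[? _]; exists m.
  have : (m + 1)%:~R <= n%:~R :> R by rewrite ler_int; lia.
  by rewrite intrD; lra.
exists (half_space F phi); split.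
- by move=> b; exact: (closed_half fineF phi_lev).
- by apply/seteqP; split => z // _; exact: half_cover.
- move=> z [[m zm sm] [n zn sn]].
  have [c [x zE]] := cell_pt_surj z; rewrite zE height_cell_pt in zm zn.
  rewrite zE (side_cell fineF phi_lev zm) in sm.
  rewrite zE (side_cell fineF phi_lev zn) in sn.
  have [j jm] := strip_corner fineF zm; have [k kn] := strip_corner fineF zn.
  have := phiE c j k; rewrite -(cell_side_corner phi_lev jm) -(cell_side_corner phi_lev kn).
  rewrite sm sn /= jm kn => /esym/andP[/eqP mn /asboolP[y Ty]].
  have [l xl] := half_at _ _ _ mn zm zn.
  by rewrite zE; exact: (track_cell fineF cT Ty xl).
move=> m n C1 C2 mn [w1 _ C1E] [w2 _ C2E] TC1 TC2.
have sub1 : C1 `<=` strip m by rewrite C1E; exact: connected_component_sub.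
have sub2 : C2 `<=` strip n by rewrite C2E; exact: connected_component_sub.
have cn1 : connected C1 by rewrite C1E; exact: component_connected.
have cn2 : connected C2 by rewrite C2E; exact: component_connected.
have [z Tz] : exists z, T z.
  by case: cT => z hz ->; exists z; exact: connected_component_refl.
have zm := sub1 _ (TC1 _ Tz); have zn := sub2 _ (TC2 _ Tz).
rewrite !between_strip in zm zn.
have ne : side F phi n z = ~~ side F phi m z.
  have [c [x zE]] := cell_pt_surj z; rewrite zE height_cell_pt in zm zn.
  have [j jm] := strip_corner fineF zm; have [k kn] := strip_corner fineF zn.
  rewrite zE (side_cell fineF phi_lev zm) (side_cell fineF phi_lev zn).
  rewrite (cell_side_corner phi_lev jm) (cell_side_corner phi_lev kn).
  have := phiE c j k; rewrite jm kn; have -> /= : m != n by exact/eqP.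
  have -> : `[< cell_meets c T >] by apply/asboolP; exists x; rewrite -zE.
  by case: (phi _) (phi _) => -[].
exists (side F phi m z); split => w Cw.
  exists m; first by rewrite -between_strip; exact: sub1.
  by rewrite -(side_connected fineF phi_lev cn1 sub1 (TC1 _ Tz) Cw).
exists n; first by rewrite -between_strip; exact: sub2.
by rewrite -ne (side_connected fineF phi_lev cn2 sub2 (TC2 _ Tz) Cw).
Qed.

Definition track_type := set_type (components (@half_level R G P F)).

Definition track_link (s t : track_type) : Prop := exists (n : int) (C : set (complex R P)),
  [/\ components (strip n) C, set_val s `<=` C & set_val t `<=` C].

Lemma trackP (s : track_type) : track (set_val s).
Proof. exact: set_mem (valP s). Qed.

Lemma track_connected T : track T -> connected T.
Proof. by case => w _ ->; exact: component_connected. Qed.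

Lemma track_nonempty T : track T -> T !=set0.
Proof. by case => z hz ->; exists z; exact: connected_component_refl. Qed.

Lemma track_in_component lo hi T C z : track T -> components (between F lo hi) C ->
  T z -> C z -> T `<=` C.
Proof.
move=> cT cC Tz Cz; rewrite (component_eq cC Cz).
have zb : between F lo hi z by case: cC Cz => w _ -> /connected_component_sub.
apply: connected_component_max => //; last exact: track_connected.
by move=> w Tw; rewrite /between /= (track_height cT Tz Tw).
Qed.

Lemma connected_one_side (H : bool -> set (complex R P)) (C T : set (complex R P)) b :
  (forall b, closed (H b)) -> H true `|` H false = setT -> H true `&` H false `<=` T ->
  connected C -> C `&` T = set0 -> C `&` H b !=set0 -> C `<=` H b.
Proof.
move=> cH HT HI cC CT Cb; apply: (connected_closed_split cC (cH b) (cH (~~ b))) => //.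
  move=> z _; have : (H true `|` H false) z by rewrite HT.
  by case: b {Cb} => -[]; [left|right|right|left].
apply/seteqP; split => z //= [Cz [hb hn]].
have Tz : T z by apply: HI; case: b hb hn {Cb} => hb hn.
by have : (C `&` T) z by []; rewrite CT.
Qed.

(** The neighbours of [e i] lie on opposite sides: if the strips that link them
    to [e i] were equal, they would be linked to each other.  The links further
    away do not meet [e i], so they do not change sides. *)
Lemma geodesic_separates N e i : geodesic track_link N e -> (0 < i < N)%N ->
  exists (H : bool -> set (complex R P)) b,
  [/\ forall b, closed (H b), H true `|` H false = setT,
      H true `&` H false `<=` set_val (e i), set_val (e 0%N) `<=` H b &
      set_val (e N) `<=` H (~~ b)].
Proof.
move=> [we geo] /andP[i0 iN].
have [H [cH HT HI Hsep]] := track_separates (trackP (e i)).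
have [n1 [C1 [cC1 s1 t1]]] : track_link (e i.-1) (e i).
  by rewrite -{2}(prednK i0); apply: we; lia.
have [n2 [C2 [cC2 t2 s2]]] := we i iN.
have [z Tz] := track_nonempty (trackP (e i)).
have n12 : n1 <> n2.
  move=> n12; subst n2.
  have C12 : C1 = C2 by rewrite (component_eq cC1 (t1 _ Tz)) (component_eq cC2 (t2 _ Tz)).
  subst C2; have : (i.+1 <= i.-1.+1)%N by apply: geo; [lia|lia|exists n1, C1].
  by lia.
have [b [C1b C2b]] := Hsep _ _ _ _ n12 cC1 cC2 t1 t2.
(* links away from [e i] avoid it, since they would otherwise shorten the walk *)
have step b' j : (j < N)%N -> (j.+1 < i)%N || (i < j)%N ->
    forall C n, components (strip n) C -> set_val (e j) `<=` C -> set_val (e j.+1) `<=` C ->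
    C `&` H b' !=set0 -> C `<=` H b'.
  move=> jN ji C n cC sj sj1; apply: connected_one_side cH HT HI _ _.
    by case: cC => w _ ->; exact: component_connected.
  apply/seteqP; split => w //= [Cw Tw].
  have TC := track_in_component (trackP (e i)) cC Tw Cw.
  case/orP: ji => ji.
    by have : (i <= j.+1)%N by [apply: geo; [lia|lia|exists n, C]]; lia.
  by have : (j.+1 <= i.+1)%N by [apply: geo; [lia|lia|exists n, C]]; lia.
have down k : (k <= i.-1)%N -> set_val (e (i.-1 - k)%N) `<=` H b.
  elim: k => [|k IH] ki; first by rewrite subn0; exact: subset_trans C1b.
  have kE : (i.-1 - k = (i.-1 - k.+1).+1)%N by lia.
  have [|n [C [cC sC tC]]] := we (i.-1 - k.+1)%N; first lia.
  apply: (subset_trans sC); apply: (step b (i.-1 - k.+1)%N _ _ C n) => //; try lia.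
  have [w Tw] := track_nonempty (trackP (e (i.-1 - k)%N)).
  by exists w; split; [apply: tC; rewrite -kE|apply: IH => //; lia].
have up k : (i.+1 + k <= N)%N -> set_val (e (i.+1 + k)%N) `<=` H (~~ b).
  elim: k => [|k IH] ki; first by rewrite addn0; exact: subset_trans C2b.
  have [|n [C [cC sC tC]]] := we (i.+1 + k)%N; first lia.
  rewrite addnS; apply: (subset_trans tC).
  apply: (step (~~ b) (i.+1 + k)%N _ _ C n) => //; try lia.
  have [w Tw] := track_nonempty (trackP (e (i.+1 + k)%N)).
  by exists w; split; [exact: sC|apply: IH => //; lia].
exists H, b; split => //.
  by have := down i.-1 (leqnn _); rewrite subnn.
by have := up (N - i.+1)%N; rewrite subnKC //; apply.
Qed.

End Separation.

(** * Connectedness of the graph of tracks *)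

Section TrackGraph.
Context {R : realType} {G : groupType} {P : tri_presentation G} {F : G -> R} {D : R}
  (fineF : fine_pseudocharacter P F D).
Implicit Types (c : G * cell_orbit P).
Notation strip n := (between (P:=P) F (n%:~R - 1 / 2) (n%:~R + 1 / 2)).
Notation track_type := (@track_type R G P F).

Lemma track_through (z : complex R P) : @half_level R G P F z ->
  exists s : track_type, set_val s z.
Proof.
move=> hz; have cs : components (half_level F) (connected_component (half_level F) z).
  by exists z.
by exists (SigSub (mem_set cs)); exact: connected_component_refl.
Qed.

Definition region (a : G) : set (complex R P) :=
  connected_component (strip (lev F a)) (vertex_pt a).

Lemma region_component a : components (strip (lev F a)) (region a).
Proof.
exists (vertex_pt a) => //; rewrite between_strip height_vertex.
exact: ltW (levP fineF a).
Qed.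

Lemma cell_in_region c x (j : 'I_(cell_dim c.2).+1) :
  in_strip (lev F (corner c j)) (cell_height F c x) -> region (corner c j) (@cell_pt _ _ _ c x).
Proof.
move=> xj; rewrite /region -cell_corner_pt; apply: linked_cell.
  have := levP fineF (corner c j); rewrite /level cell_height_corner ltr_norml.
  by move=> /andP[? ?]; apply/andP; split; lra.
by move: xj; rewrite /in_strip ler_norml => /andP[? ?]; apply/andP; split; lra.
Qed.

Lemma track_in_region (s : track_type) c x (j : 'I_(cell_dim c.2).+1) :
  set_val s (@cell_pt _ _ _ c x) -> in_strip (lev F (corner c j)) (cell_height F c x) ->
  set_val s `<=` region (corner c j).
Proof.
move=> sx xj; apply: (track_in_component (trackP s) (region_component _) sx).
exact: cell_in_region.
Qed.

Lemma half_in_strip (m n : int) : n = m \/ n = m + 1 -> in_strip (R:=R) n (m%:~R + 2^-1).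
Proof.
case=> ->; rewrite /in_strip ?intrD ler_norml; apply/andP; split; lra.
Qed.

Lemma track_has_region (s : track_type) : exists a, set_val s `<=` region a.
Proof.
have [z sz] := track_nonempty (trackP s).
have [m] : half_level F z.
  by case: (trackP s) sz => w _ -> /connected_component_sub.
have [c [x zE]] := cell_pt_surj z; rewrite zE height_cell_pt => xm.
have xs : in_strip m (cell_height F c x) by rewrite xm; apply: half_in_strip; left.
have [j jm] := strip_corner fineF xs; exists (corner c j).
by apply: (@track_in_region s c x); rewrite -?zE // jm.
Qed.

Lemma region_step a (s : gens P) : region a = region (a * gen s)%g \/
  exists r : track_type, set_val r `<=` region a /\ set_val r `<=` region (a * gen s)%g.
Proof.
have [e|ne] := eqVneq (lev F a) (lev F (a * gen s)%g).
  left; rewrite {2}/region -e; apply: (component_eq (region_component a)).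
  have := @cell_in_region (a, Edge s) (corner_pt ord_max) ord0.
  rewrite cell_height_corner edge_corner_pt corner_edge0 corner_edge1 e; apply.
  exact: ltW (levP fineF _).
right; have [|x [m xm]] := corners_crossing fineF (c := (a, Edge s)) (j := ord0) (k := ord_max).
  by rewrite corner_edge0 corner_edge1.
have [|r rx] := @track_through (@cell_pt _ _ _ (a, Edge s) x).
  by exists m; rewrite height_cell_pt.
have x0 := cell_height_close fineF x ord0; have x1 := cell_height_close fineF x ord_max.
have l0 := levP fineF (corner (a, Edge s) ord0).
have l1 := levP fineF (corner (a, Edge s) ord_max).
have in_s (j : 'I_2) : in_strip (lev F (corner (a, Edge s) j)) (cell_height F (a, Edge s) x).
  rewrite xm; apply: half_in_strip.
  have := cell_height_close fineF x j; have := levP fineF (corner (a, Edge s) j).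
  rewrite /level xm !ltr_norml; move: (F _) (lev F _) => y l /andP[? ?] /andP[? ?].
  have [lm|ml] := lerP l m; [left|right].
    apply: (@int_close R); rewrite -(ler_int R) in lm.
    by rewrite ltr_norml; apply/andP; split; lra.
  have ml' : m + 1 <= l by lia.
  apply: (@int_close R); rewrite ltr_norml intrD; rewrite -(ler_int R) intrD in ml'.
  apply/andP; split; lra.
exists r; split.
  by have := @track_in_region r (a, Edge s) x ord0 rx (in_s ord0); rewrite corner_edge0.
by have := @track_in_region r (a, Edge s) x ord_max rx (in_s ord_max); rewrite corner_edge1.
Qed.

(** Each track lies in the region of some vertex, and the regions of adjacent
    vertices are equal or share a track. *)
Lemma track_graph_connected (s t : track_type) :
  clos_refl_trans _ (@track_link R G P F) s t.
Proof.
pose reached a := forall t : track_type, set_val t `<=` region a ->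
  clos_refl_trans _ (@track_link R G P F) s t.
have link a (r t' : track_type) : set_val r `<=` region a -> set_val t' `<=` region a ->
    clos_refl_trans _ (@track_link R G P F) r t'.
  move=> ra ta; apply: rt_step; exists (lev F a), (region a); split => //.
  exact: region_component.
have step a (x : gens P) : reached a <-> reached (a * gen x)%g.
  case: (region_step a x) => [e|[r [r1 r2]]]; first by rewrite /reached e.
  split => ra t' ta; apply: rt_trans (ra r _) _ => //; first exact: link ta.
  exact: link ta.
have [a sa] := track_has_region s; have [b tb] := track_has_region t.
suff : reached b by apply.
have [w wE] := @gen_surj G P (a^-1 * b)%g.
have -> : b = (a * word_val (@gen G P) w)%g by rewrite wE mulVKg.
have : reached a by move=> t' ta; exact: link ta.
elim: w {sa tb wE} a => [|[x e] w IH] a ra /=; first by rewrite mulg1.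
rewrite mulgA; apply: IH; case: e; rewrite /letter_val /=; first exact/(step a x).
by apply/(step _ x); rewrite mulgVK.
Qed.

End TrackGraph.

(** * The bottleneck property of the graph X *)

Section GraphX.
Context {R : realType} {G : groupType} {P : tri_presentation G} {F : G -> R} {D : R}
  (fineF : fine_pseudocharacter P F D).
Notation strip n := (between (P:=P) F (n%:~R - 1 / 2) (n%:~R + 1 / 2)).
Notation slab n := (between (P:=P) F (n%:~R - 3 / 2) (n%:~R + 2^-1)).
Notation track_type := (@track_type R G P F).
Notation X := (@X_graph R G P F).
Notation translate := (@translate R G P F).
Implicit Types (g h : G) (u v : X).

Lemma translate_connected h u : connected (translate h u).
Proof.
apply: connected_continuous_connected; first exact: track_connected (trackP u.2).
by apply: continuous_subspaceT => z; exact: act_continuous.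
Qed.

Lemma act1_image (A : set (complex R P)) : complex_act 1%g @` A = A.
Proof.
by apply/seteqP; split => [_ [z Az <-]|z Az]; [rewrite act1|exists z; rewrite ?act1].
Qed.

Lemma translate1 (s : track_type) : translate 1%g (1%g, s) = set_val s.
Proof. by rewrite /Defs.translate /= mulg1 act1_image. Qed.

Lemma translateV h (s : track_type) : translate h ((h^-1)%g, s) = set_val s.
Proof. by rewrite /Defs.translate /= mulgV act1_image. Qed.

Lemma translate_nonempty h u : translate h u !=set0.
Proof. by have [z uz] := track_nonempty (trackP u.2); exists (complex_act (h * u.1)%g z), z. Qed.

Lemma translate_act h k u z : translate k u z -> translate (h * k)%g u (complex_act h z).
Proof. by move=> [w uw <-]; exists w => //; rewrite act_comp mulgA. Qed.

(** Moving a track distorts its height by at most [2 * D]. *)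
Lemma translate_thin h u z z' : translate h u z -> translate h u z' ->
  `|height F z - height F z'| < 1 / 4.
Proof.
move=> [w uw <-] [w' uw' <-]; have e := track_height (trackP u.2) uw uw'.
have := height_act fineF (h * u.1)%g w; have := height_act fineF (h * u.1)%g w'.
have := fineD_small fineF; rewrite e !ler_norml ltr_norml => ? /andP[? ?] /andP[? ?].
by apply/andP; split; lra.
Qed.

Lemma step_of_component h (n : int) (C : set (complex R P)) u v :
  components (slab n) C -> translate h u `<=` C -> translate h v `<=` C -> step u v.
Proof.
move=> cC uC vC; case: (eqVneq u v) => [->|uv]; first by left.
by right; rewrite /= /X_adj uv; apply/asboolP; exists h, n, C.
Qed.

Lemma step_of_linked h (n : int) u v z z' : translate h u `<=` slab n ->
  translate h v `<=` slab n -> translate h u z -> translate h v z' ->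
  linked F (n%:~R - 3 / 2) (n%:~R + 2^-1) z z' -> step u v.
Proof.
move=> us vs uz vz' zz'.
apply: (@step_of_component h n (connected_component (slab n) z)).
- by exists z => //; exact: us.
- by apply: connected_component_max => //; exact: translate_connected.
- rewrite (same_connected_component zz').
  by apply: connected_component_max => //; exact: translate_connected.
Qed.

Lemma track_above c x (a : 'I_(cell_dim c.2).+1) lo (m : int) :
  lo <= cell_height F c x <= m%:~R + 2^-1 -> lo <= F (corner c a) < m%:~R + 2^-1 ->
  exists s : track_type, exists z, [/\ set_val s z, height F z = m%:~R + 2^-1 &
    linked F lo (m%:~R + 2^-1) (@cell_pt _ _ _ c x) z].
Proof.
move=> xm /andP[la am]; have [z zm az] := ascent fineF am.
have [s sz] := @track_through R G P F z (ex_intro _ m zm).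
exists s, z; split => //; apply: (@linked_trans _ _ _ _ _ _ (vertex_pt (corner c a))).
  rewrite -cell_corner_pt; apply: linked_cell => //.
  by rewrite cell_height_corner la ltW.
exact: linkedW az.
Qed.

(** The translate has height close to that of [z], so it may leave the slab only
    near the top or the bottom.  Near the top, and in the middle, a climb from a
    low corner of the cell of [z] to height [n + 1 / 2] stays in the slab and in
    a slab [k] that contains the translate.  Near the bottom, a climb from a
    high corner to height [n - 1 / 2] does so. *)
Lemma meeting_component h u (n : int) (C : set (complex R P)) z :
  components (slab n) C -> C z -> translate h u z ->
  exists s : track_type, set_val s `<=` C /\ step u ((h^-1)%g, s).
Proof.
move=> cC Cz uz; have /andP[zlo zhi] : slab n z by case: cC Cz => w _ -> /connected_component_sub.
have [c [x zE]] := cell_pt_surj z; rewrite zE height_cell_pt in zlo zhi.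
have hz : height F z = cell_height F c x by rewrite zE height_cell_pt.
have thin w : translate h u w -> cell_height F c x - 1 / 4 < height F w < cell_height F c x + 1 / 4.
  move=> uw; have := translate_thin uz uw; rewrite hz ltr_norml => /andP[? ?].
  by apply/andP; split; lra.
(* it suffices to find a track at height [m + 1 / 2] in the overlap of [C] with a slab [k]
   that contains the translate *)
suff [s [w [m [k [lo [sw [wm zw lok losn]]]]]]] : exists (s : track_type) w (m k : int) (lo : R),
    set_val s w /\ [/\ height F w = m%:~R + 2^-1,
     linked F lo (m%:~R + 2^-1) z w,
     translate h u `<=` slab k &
     [/\ n%:~R - 3 / 2 <= lo, m <= n, k%:~R - 3 / 2 <= lo & m <= k]].
  have [nlo mn klo mk] := losn.
  have mn' : m%:~R + 2^-1 <= n%:~R + 2^-1 :> R by rewrite lerD2r ler_int.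
  have mk' : m%:~R + 2^-1 <= k%:~R + 2^-1 :> R by rewrite lerD2r ler_int.
  have zwn := linkedW nlo mn' zw; have zwk := linkedW klo mk' zw.
  exists s; split.
    apply: (track_in_component (trackP s) cC sw).
    by rewrite (component_eq cC Cz).
  apply: (step_of_linked (h := h) (n := k) lok _ uz _ zwk); rewrite translateV //.
  have /andP[w1 w2] : slab k w by exact: connected_component_sub zwk.
  by move=> w' sw'; rewrite /between /= (track_height (trackP s) sw sw') w1.
have [j jx] := @corner_le R G P F c x; have [i xi] := @corner_ge R G P F c x.
have := cell_height_close fineF x j; have := cell_height_close fineF x i.
rewrite !ltr_norml => /andP[? ?] /andP[? ?].
have [zhigh|zlow] := lerP (n%:~R - 5 / 4) (cell_height F c x); last first.
  have [||s [w [sw wm zw]]] := @track_above c x i (cell_height F c x) (n - 1).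
  - by rewrite lexx intrB; lra.
  - by rewrite xi intrB; lra.
  exists s, w, (n - 1), (n - 1), (cell_height F c x); split => //; split => //.
  - by rewrite zE.
  - by move=> w' /thin /andP[? ?]; apply/andP; rewrite intrB; split; lra.
  - by split=> //; [lia|rewrite intrB; lra].
have jn : F (corner c j) < n%:~R + 2^-1.
  rewrite lt_neqAle (le_trans jx zhi) andbT; apply/eqP => e.
  by apply: (@fine_half _ _ _ _ _ fineF (corner c j) n); rewrite e; lra.
have [||s [w [sw wm zw]]] := @track_above c x j (F (corner c j)) n.
- by rewrite jx zhi.
- by rewrite lexx jn.
have [above|below] := lerP (n%:~R - 1 / 4) (cell_height F c x).
  exists s, w, n, (n + 1), (F (corner c j)); split => //; split => //.
  - by rewrite zE.
  - by move=> w' /thin /andP[? ?]; apply/andP; rewrite intrD; split; lra.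
  - by split=> //; [lra|rewrite intrD; lra|lia].
exists s, w, n, n, (F (corner c j)); split => //; split => //.
- by rewrite zE.
- by move=> w' /thin /andP[? ?]; apply/andP; split; lra.
- by split=> //; lra.
Qed.

Lemma near_track u : exists s : track_type, step u (1%g, s).
Proof.
have [z uz] := translate_nonempty 1%g u.
pose n := Num.floor (height F z + 1 / 2).
have zn : slab n z.
  have := floor_itv (height F z + 1 / 2); rewrite -/n intrD => /andP[? ?].
  by apply/andP; split; lra.
have cC : components (slab n) (connected_component (slab n) z) by exists z.
have [s [_ us]] := meeting_component cC (connected_component_refl zn) uz.
by exists s; rewrite invg1 in us.
Qed.

Lemma track_link_step (s t : track_type) : track_link s t -> step ((1%g, s) : X) (1%g, t).
Proof.
move=> [n [C [cC sC tC]]].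
have [z Cz] := track_nonempty (trackP s); have {}Cz := sC _ Cz.
apply: (@step_of_component 1%g n (connected_component (slab n) z)); rewrite ?translate1.
- exists z => //; have /andP[? ?] : strip n z by case: cC Cz => w _ -> /connected_component_sub.
  by apply/andP; split; lra.
- rewrite -/(set_val s); apply: (subset_trans sC); rewrite (component_eq cC Cz).
  by apply: connected_component_mono => w /andP[? ?]; apply/andP; split; lra.
- apply: (subset_trans tC); rewrite (component_eq cC Cz).
  by apply: connected_component_mono => w /andP[? ?]; apply/andP; split; lra.
Qed.

(** The slab component behind the step, moved back by [h], is connected.  If
    it met [s], both ends would be within two steps of [s] by [meeting_component]. *)
Lemma step_one_side (H : bool -> set (complex R P)) b (s : track_type) u v :
  (forall b, closed (H b)) -> H true `|` H false = setT -> H true `&` H false `<=` set_val s ->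
  step u v -> ~ (within 2 u (1%g, s) /\ within 2 v (1%g, s)) ->
  translate 1%g u `<=` H b -> translate 1%g v `<=` H b.
Proof.
move=> cH HT HI [->//|/andP[_ /asboolP[h [n [C [cC uC vC]]]]]] far uH.
pose U := complex_act (h^-1)%g @` C.
have sub w : translate h w `<=` C -> translate 1%g w `<=` U.
  move=> wC z wz; exists (complex_act h z); last by rewrite act_comp mulVg act1.
  by have := translate_act h wz; rewrite mulg1; exact: wC.
apply: (subset_trans (sub v vC)); apply: (connected_one_side cH HT HI).
- apply: connected_continuous_connected; first by case: cC => w _ ->; exact: component_connected.
  by apply: continuous_subspaceT => z; exact: act_continuous.
- apply/seteqP; split => // _ [[z Cz <-] sz]; apply: far.
  have sz' : translate h (1%g, s) z.
    by exists (complex_act (h^-1)%g z); rewrite //= act_comp mulg1 mulgV act1.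
  have [t [tC st]] := meeting_component cC Cz sz'.
  have near (w : X) : translate h w `<=` C -> within 2 w (1%g, s).
    move=> wC; exists ((h^-1)%g, t); last exact/within1/stepC.
    by apply: step_of_component cC wC _; rewrite translateV.
  by split; exact: near.
- have [z uz] := translate_nonempty 1%g u.
  by exists z; split; [exact: sub uC _ uz|exact: uH].
Qed.

(** The coarse path is a shortest chain of linked tracks.  A path that avoids the
    neighbourhood of an inner track of the chain stays in one half-space, but the
    ends of the chain lie in different ones. *)
Lemma X_bottleneck : bottleneck X.
Proof.
move=> x y; have [s xs] := near_track x; have [t yt] := near_track y.
have [N [e [geo e0 eN]]] := geodesic_exists (track_graph_connected fineF s t).
exists N, (fun i => (1%g, e i)); split.
- by rewrite e0.
- by rewrite eN; exact: stepC.
- by move=> i iN; apply: track_link_step; exact: geo.1.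
move=> Q i iN xyQ.
have [i0|i0] := posnP i.
  exists x; first exact: joined_left xyQ.
  by exists (1%g, s); rewrite // i0 e0; exact: within1 (step_refl _).
have y_near : within 2 y ((1%g, e N) : X).
  by exists (1%g, t); rewrite ?eN //; exact: within1 (step_refl _).
have [->|neN] := eqVneq i N; first by exists y => //; exact: joined_right xyQ.
have i_in : (0 < i < N)%N by rewrite i0 ltn_neqAle neN iN.
have [H [b [cH HT HI sH tH]]] := geodesic_separates fineF geo i_in.
rewrite e0 in sH; rewrite eN in tH.
apply: contrapT => far.
have farQ w : Q w -> ~ within 2 w ((1%g, e i) : X) by move=> Qw wi; apply: far; exists w.
have cross := step_one_side cH HT HI.
have yH : translate 1%g y `<=` H b.
  have xH : translate 1%g x `<=` H b.
    apply: (cross _ (1%g, s) x (stepC xs)); last by rewrite translate1.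
    by move=> [_]; apply: farQ; exact: joined_left xyQ.
  elim: xyQ xH => // a c d Qa ac _ IH aH; apply: IH.
  by apply: cross ac _ aH => -[/farQ].
have tH' : set_val t `<=` H b.
  rewrite -translate1; apply: cross yt _ yH => -[+ _]; apply: farQ; exact: joined_right xyQ.
have [z tz] := track_nonempty (trackP t).
have iz : set_val (e i) z.
  by apply: HI; move: (tH _ tz) (tH' _ tz); case: (b) => h1 h2; split.
have et : e i = t.
  apply: val_inj.
  exact: etrans (component_eq (trackP (e i)) iz) (esym (component_eq (trackP t) tz)).
by apply: far; exists y; [exact: joined_right xyQ|rewrite et -eN].
Qed.

(** A cell that meets the track is moved so that its first corner becomes [1]. *)
Lemma track_near_one (s : track_type) : exists a z,
  [/\ exists2 w, set_val s w & complex_act (a^-1)%g w = z,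
      `|height F z| < 1 / 4 & linked F (- (1 / 4)) (1 / 4) z (vertex_pt 1%g)].
Proof.
have [w sw] := track_nonempty (trackP s); have [[a o] [x wE]] := cell_pt_surj w.
exists a, (complex_act (a^-1)%g w); set z := complex_act _ _.
have zE : z = @cell_pt R G P (1%g, o) x by rewrite /z wE /cell_pt act_pi /act_cells /pt /= mulVg.
have c0 : corner ((1%g, o) : G * cell_orbit P) (ord0 : 'I_(cell_dim o).+1) = 1%g.
  by rewrite /corner /= take0 mulg1.
have := @cell_height_close _ _ _ _ _ fineF (1%g, o) x ord0; rewrite c0 (fine1 fineF) subr0 => x1.
split; first by exists w.
  by rewrite zE height_cell_pt.
rewrite zE -{2}c0 -(@cell_corner_pt R G P (1%g, o) ord0); apply: linked_cell.
  by move: x1; rewrite ltr_norml => /andP[? ?]; apply/andP; split; lra.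
by rewrite cell_height_corner c0 (fine1 fineF); apply/andP; split; lra.
Qed.

Definition X_act g u : X := ((g * u.1)%g, u.2).

Lemma X_act_step g u v : step u v -> step (X_act g u) (X_act g v).
Proof.
move=> [->|/andP[_ /asboolP[h [n [C [cC uC vC]]]]]]; first by left.
have tr w : translate (h * g^-1)%g (X_act g w) = translate h w.
  by rewrite /Defs.translate /= mulgA mulgVK.
by apply: (@step_of_component (h * g^-1)%g n C) => //; rewrite tr.
Qed.

(** After moving, both tracks stay near height [0], in the slab with [n = 0]. *)
Lemma X_cobounded u v : exists g, step (X_act g u) v.
Proof.
have [a [z [zu zh z1]]] := track_near_one u.2; have [b [w [wv wh w1]]] := track_near_one v.2.
pose h := (b^-1 * v.1^-1)%g; pose g := (h^-1 * a^-1 * u.1^-1)%g.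
have uz : translate h (X_act g u) z.
  rewrite /Defs.translate /= /g; have -> : (h * (h^-1 * a^-1 * u.1^-1 * u.1) = a^-1)%g.
    by rewrite mulgVK mulgA mulgV mul1g.
  by case: zu => p sp pE; exists p.
have vw : translate h v w.
  by rewrite /Defs.translate /= /h mulgVK; case: wv => p sp pE; exists p.
have in_slab x y : translate h x y -> `|height F y| < 1 / 4 -> translate h x `<=` slab 0.
  move=> xy y1 y' xy'; have := translate_thin xy xy'; move: y1.
  by rewrite !ltr_norml => /andP[? ?] /andP[? ?]; apply/andP; split; lra.
exists g; apply: (step_of_linked (in_slab _ _ uz zh) (in_slab _ _ vw wh) uz vw).
apply: (@linkedW _ _ _ _ (- (1 / 4)) (1 / 4)); [lra|lra|].
exact: linked_trans z1 (linkedC w1).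
Qed.

End GraphX.

(** * Rescaled pseudocharacters *)

Section Scaling.
Context {R : realType} {G : groupType}.
Implicit Types f : G -> R.

Lemma defects_nonempty f : defects f !=set0.
Proof. by exists `|f 1%g + f 1%g - f (1 * 1)%g|, 1%g, 1%g. Qed.

Lemma le_defect f a b : is_pseudocharacter f -> `|f a + f b - f (a * b)%g| <= defect f.
Proof. by move=> [_ bnd]; apply: (ub_le_sup bnd); exists a, b. Qed.

Lemma pseudocharacter_scale f c : is_pseudocharacter f -> 0 < c ->
  is_pseudocharacter (fun g => c * f g) /\ defect (fun g => c * f g) <= c * defect f.
Proof.
move=> fP c0; have bound : ubound (defects (fun g => c * f g)) (c * defect f).
  move=> _ [a [b ->]]; rewrite -mulrDr -mulrBr normrM gtr0_norm // ler_pM2l //.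
  exact: le_defect.
split; last by apply: ge_sup => //; exact: defects_nonempty.
split; last by exists (c * defect f).
by move=> a n; rewrite fP.1 mulrCA.
Qed.

Lemma pseudocharacterV f a : is_pseudocharacter f -> f (a^-1)%g = - f a.
Proof. by move=> fP; have := fP.1 a (Negz 0); rewrite /= expg1 NegzE mulrNz mulN1r. Qed.

(** Finiteness of the generating set makes the supremum in [epsilon] an upper bound. *)
Lemma pseudocharacter_fine (P : tri_presentation G) f c :
  is_pseudocharacter f -> (exists s : gens P, defect f < f (gen s)) -> 0 < c ->
  epsilon P (fun g => c * f g) < 1 / 4 ->
  (forall g (n : int), c * f g <> n%:~R + 1 / 2) ->
  fine_pseudocharacter P (fun g => c * f g) (defect (fun g => c * f g)).
Proof.
move=> fP [s fs] c0 small half; have [cfP cf] := pseudocharacter_scale fP c0.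
split.
- by move=> a b; exact: le_defect.
- move=> t; apply: le_lt_trans small; rewrite lerD2r; apply: ub_le_sup; last by exists t.
  exists (\sum_(t : gens P) `|c * f (gen t)|) => _ [t' _ <-].
  by rewrite (bigD1 t') //= lerDl sumr_ge0.
- by move=> a; rewrite (pseudocharacterV a fP) mulrN.
- exact: half.
- by exists s; apply: le_lt_trans cf _; rewrite ltr_pM2l.
Qed.

End Scaling.

Theorem corollary4p16 (R : realType) (G : groupType) (f : G -> R)
    (P : tri_presentation G) (c : R) :
  is_pseudocharacter f ->
  (exists s : gens P, defect f < f (gen s)) ->
  0 < c ->
  let fc := fun g : G => c * f g in
  epsilon P fc < 1 / 4 ->
  (forall (g : G) (n : int), fc g <> n%:~R + 1 / 2) ->
  exists Gamma : sgraph,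
    [/\ is_tree Gamma,
        quasi_isometric (@graph_dist R (X_graph P fc)) (@graph_dist R Gamma) &
        quasi_acts_coboundedly G (@graph_dist R Gamma)].
Proof.
move=> fP fs c0 fc small half.
have fine := pseudocharacter_fine fP fs c0 small half.
have [z zh _] : exists2 z : complex R P, height fc z = 0%:~R + 2^-1 &
    linked fc (fc 1%g) (0%:~R + 2^-1) (vertex_pt 1%g) z.
  by apply: (ascent fine); rewrite (fine1 fine); lra.
have [s _] := track_through (ex_intro _ (0 : int) zh).
apply: (@bottleneck_quasi_tree R (X_graph P fc) G (@X_act R G P fc) (1%g, s)).
- by case=> g t; rewrite /X_act mul1g.
- by move=> g h [k t]; rewrite /X_act /= mulgA.
- exact: X_act_step.
- exact: (X_cobounded fine).
- exact: (X_bottleneck fine).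
Qed.
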